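(* A cube or a cuboid cannot be obtained from a tetrahedron by a finite sequence of tetrahedron attachments each of which is of one of the following types: (i) with one face identified and no edge vanishing; (ii) with one face identified and only one edge vanishing; (iii) with one face identified and two edges and their common vertex vanishing; (iv) with one face identified and its three edges and its three vertices vanishing; (v) with two faces identified, their common edge vanishing, its opposite edge in the attached tetrahedron becoming a new edge, and the remaining four edges of the attached tetrahedron not vanishing.
   Context: Polyhedra here are solids in $\mathbb{R}^3$ bounded by finitely many polygonal faces, not necessarily convex. Attaching a tetrahedron $T$ to a polyhedron $\mathcal{P}$ means forming $\mathcal{Q}=\mathcal{P}\cup T$, where $\mathcal{P}\cap T$ is exactly one triangular face of $\mathcal{P}$ that is also a face of $T$ (one face identified), or exactly the union of two triangular faces of $\mathcal{P}$ sharing an edge that are also two faces of $T$ (two faces identified). An edge or vertex of $\mathcal{P}$ vanishes if it is no longer an edge or vertex of $\mathcal{Q}$. In detail: (i) The identified face is replaced by the other three triangles of $T$; all edges of $\mathcal{P}$ remain, and three new edges to the new apex are added. (ii) Exactly one edge $b$ of the identified face vanishes: the face of $T$ other than the identified one that contains $b$ is coplanar with, and merges into, the other face $G$ of $\mathcal{P}$ containing $b$, so that in the boundary of the new face the edge $b$ is replaced by two of the three new edges of $T$. The other two triangles of $T$ become new faces. (iii) Two edges $a,b$ of the identified face, meeting at a vertex $v$, vanish together with $v$: $v$ is incident in $\mathcal{P}$ with exactly one further edge $y$, the edge of $T$ from $v$ to its apex is a straight extension of $y$ and forms with $y$ a single edge of $\mathcal{Q}$, and the triangles of $T$ containing $a$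 and $b$ merge into the neighbouring faces of $\mathcal{P}$ across $a$ and $b$. The remaining triangle of $T$ becomes a new face. (iv) All three edges and all three vertices of the identified face vanish: each of its vertices is incident in $\mathcal{P}$ with exactly one further edge, these three edges are extended straight until they meet at the apex of $T$, and the three other triangles of $T$ merge into the three neighbouring faces of $\mathcal{P}$. (v) The two identified faces share an edge $b$, which becomes interior to $\mathcal{Q}$; the edge of $T$ opposite to $b$ is a new edge of $\mathcal{Q}$, the other two triangles of $T$ are new faces of $\mathcal{Q}$, and the other four edges of $T$, which are edges of $\mathcal{P}$, remain edges of $\mathcal{Q}$. *)

(* Defs.v *)
From HB Require Import structures.
From mathcomp Require Import all_boot all_order all_algebra.
From mathcomp Require Import all_classical all_reals all_analysis.

Set Implicit Arguments.
Unset Strict Implicit.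
Unset Printing Implicit Defensive.

Import Order.TTheory GRing.Theory Num.Theory.
Import numFieldNormedType.Exports.

Local Open Scope classical_set_scope.
Local Open Scope ring_scope.

(** A solid is a set of points of R^3.  Its vertices, edges and faces are not
    extra data: they are read off from the set itself, so that a union of
    solids has well-defined vertices, edges and faces. *)

Notation point R := 'rV[R]_3.

Section Hulls.
Variable R : realType.
Implicit Types p q r w : point R.

Definition hull (s : seq (point R)) : set (point R) :=
  [set x | exists c : 'I_(size s) -> R,
     [/\ forall i, 0 <= c i, \sum_i c i = 1 & x = \sum_i c i *: s`_i]].

Definition segment p q := hull [:: p; q].
Definition triangle p q r := hull [:: p; q; r].
Definition tetrahedron p q r w := hull [:: p; q; r; w].

Definition open_segment p q : set (point R) :=
  [set x | exists t : R, 0 < t < 1 /\ x = (1 - t) *: p + t *: q].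

Definition noncollinear p q r := row_free (col_mx (q - p) (r - p)).
Definition noncoplanar p q r w :=
  row_free (col_mx (q - p) (col_mx (r - p) (w - p))).

(** Planar region that is a finite union of triangles. *)
Definition polygon (F : set (point R)) : Prop :=
  (exists n : point R, exists c : R,
     n != 0 /\ forall x, F x -> x *m n^T = c%:M) /\
  exists s : seq (point R * point R * point R),
    (forall t, t \in s -> noncollinear t.1.1 t.1.2 t.2) /\
    forall x, F x <-> exists2 t, t \in s & triangle t.1.1 t.1.2 t.2 x.

End Hulls.

Section Polyhedra.
Variable R : realType.
Implicit Types (A P Q : set (point R)) (p q r u v w x d : point R).

(** Near [x], the set [A] is a union of lines of direction [d]. *)
Definition locally_invariant A x d : Prop :=
  \forall y \near x & t \near (0 : R), A y <-> A (y + t *: d).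

(** For a solid bounded by planar pieces, the directions of local invariance at
    [x] form a linear subspace; its dimension is 3 off the boundary, 2 inside
    a face, 1 inside an edge and 0 at a vertex. *)
Definition stratum A (k : nat) : set (point R) :=
  [set x | exists W : 'M[R]_3,
     \rank W = k /\ forall d, locally_invariant A x d <-> (d <= W)%MS].

Definition vertices A : set (point R) := stratum A 0.

Definition edges A : set (set (point R)) :=
  [set e | exists p q, [/\ p != q, vertices A p, vertices A q,
     open_segment p q `<=` stratum A 1 & e = segment p q]].

Definition faces A : set (set (point R)) :=
  [set closure (connected_component (stratum A 2) x) | x in stratum A 2].

Definition incident_edges A v : set (set (point R)) :=
  [set e | edges A e /\ e v].

Definition polyhedron A : Prop :=
  [/\ A !=set0, compact A, A = closure A° & connected A°] /\
  [/\ finite_set (faces A),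
      forall F, faces A F -> polygon F
    & A `\` A° = \bigcup_(F in faces A) F].

(** The three sides are required to be edges: a face of triangular shape with a
    further vertex inside one of its sides does not count. *)
Definition triangular_face A p q r : Prop :=
  [/\ faces A (triangle p q r), edges A (segment p q),
      edges A (segment q r) & edges A (segment p r)].

(** An edge of [P] that is merely prolonged in [Q] is not lost: compare
    [extended_straight] below. *)
Definition vanishing_edges P Q : set (set (point R)) :=
  [set e | edges P e /\ ~ exists2 e', edges Q e' & e `<=` e'].

Definition vanishing_vertices P Q : set (point R) := vertices P `\` vertices Q.

End Polyhedra.

Section Attachments.
Variable R : realType.
Implicit Types (P Q : set (point R)) (p q r u v w x : point R).

(** The tetrahedron [p q r w] is attached along its face [p q r]; its apex is
    [w]. *)
Definition one_face_attachment P Q p q r w : Prop :=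
  [/\ polyhedron P, polyhedron Q & noncoplanar p q r w] /\
  [/\ triangular_face P p q r,
      P `&` tetrahedron p q r w = triangle p q r
    & Q = P `|` tetrahedron p q r w].

(** The tetrahedron [u v x w] is attached along its faces [u v x] and [u v w],
    which share the edge [u v]. *)
Definition two_face_attachment P Q u v x w : Prop :=
  [/\ polyhedron P, polyhedron Q & noncoplanar u v x w] /\
  [/\ triangular_face P u v x, triangular_face P u v w,
      P `&` tetrahedron u v x w = triangle u v x `|` triangle u v w
    & Q = P `|` tetrahedron u v x w].

(** The triangle [T] merges into the face of [P] that lies across the edge [e]
    of the identified face [F]. *)
Definition merges_across P Q (F e T : set (point R)) : Prop :=
  exists G, [/\ faces P G, G <> F, e `<=` G & faces Q (G `|` T)].

(** Besides [a] and [b], the vertex [v] lies on exactly one edge of [P], and the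
    segment from [v] to [w] prolongs that edge to a single edge of [Q]. *)
Definition extended_straight P Q v w (a b : set (point R)) : Prop :=
  exists u, [/\ incident_edges P v `\` [set a; b] = [set segment u v],
     open_segment u w v & edges Q (segment u w)].

Definition attachment_i P Q : Prop :=
  exists p q r w, one_face_attachment P Q p q r w /\
  [/\ vanishing_edges P Q = set0,
      edges Q = edges P `|` [set segment p w; segment q w; segment r w]
    & faces Q = (faces P `\ triangle p q r) `|`
        [set triangle p q w; triangle q r w; triangle p r w]].

Definition attachment_ii P Q : Prop :=
  exists p q r w, one_face_attachment P Q p q r w /\
  [/\ vanishing_edges P Q = [set segment q r],
      merges_across P Q (triangle p q r) (segment q r) (triangle q r w),
      [/\ edges Q (segment p w), edges Q (segment q w) & edges Q (segment r w)],
      faces Q (triangle p q w)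
    & faces Q (triangle p r w)].

Definition attachment_iii P Q : Prop :=
  exists v p q w, one_face_attachment P Q v p q w /\
  let a := segment v p in let b := segment v q in
  [/\ vanishing_edges P Q = [set a; b],
      vanishing_vertices P Q = [set v]
    & extended_straight P Q v w a b] /\
  [/\ merges_across P Q (triangle v p q) a (triangle v p w),
      merges_across P Q (triangle v p q) b (triangle v q w),
      edges Q (segment p w), edges Q (segment q w)
    & faces Q (triangle p q w)].

Definition attachment_iv P Q : Prop :=
  exists p q r w, one_face_attachment P Q p q r w /\
  let F := triangle p q r in
  let a := segment p q in let b := segment q r in let c := segment p r in
  [/\ vanishing_edges P Q = [set a; b; c],
      vanishing_vertices P Q = [set p; q; r],
      [/\ extended_straight P Q p w a c, extended_straight P Q q w a b
        & extended_straight P Q r w b c]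
    & [/\ merges_across P Q F a (triangle p q w),
          merges_across P Q F b (triangle q r w)
        & merges_across P Q F c (triangle p r w)]].

Definition attachment_v P Q : Prop :=
  exists u v x w, two_face_attachment P Q u v x w /\
  [/\ vanishing_edges P Q = [set segment u v],
      open_segment u v `<=` Q°,
      edges Q (segment x w),
      faces Q (triangle u x w) /\ faces Q (triangle v x w)
    & [/\ edges Q (segment u x), edges Q (segment v x),
          edges Q (segment u w) & edges Q (segment v w)]].

Definition attachment P Q : Prop :=
  [\/ attachment_i P Q, attachment_ii P Q, attachment_iii P Q
    | attachment_iv P Q \/ attachment_v P Q].

Inductive obtainable : set (point R) -> Prop :=
| obtainable_start p q r w :
    noncoplanar p q r w -> obtainable (tetrahedron p q r w)
| obtainable_attach P Q :
    obtainable P -> attachment P Q -> obtainable Q.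

End Attachments.

Section Cuboids.
Variable R : realType.
Implicit Types o u v w : point R.

(** Box with corner [o] and edge vectors [u], [v], [w]. *)
Definition box o u v w : set (point R) :=
  [set x | exists r s t : R, [/\ 0 <= r <= 1, 0 <= s <= 1, 0 <= t <= 1
     & x = o + r *: u + s *: v + t *: w]].

Definition orthogonal_frame u v w : Prop :=
  [/\ u != 0, v != 0 & w != 0] /\
  [/\ u *m v^T = 0, v *m w^T = 0 & u *m w^T = 0].

Definition cuboid (Q : set (point R)) : Prop :=
  exists o u v w, orthogonal_frame u v w /\ Q = box o u v w.

Definition cube (Q : set (point R)) : Prop :=
  exists o u v w, [/\ orthogonal_frame u v w, u *m u^T = v *m v^T,
    v *m v^T = w *m w^T & Q = box o u v w].

End Cuboids.

(* Main.v *)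
Require Import Defs.
From HB Require Import structures.
From mathcomp Require Import all_boot all_order all_algebra.
From mathcomp Require Import all_classical all_reals all_analysis.
From mathcomp Require Import ring lra.

(** Why the theorem holds.  Undo the attachments one by one, starting from the
    cuboid, and keep the following invariant: the solid is a convex polytope
    with nonempty interior, and no two distinct triangular faces of it share
    an edge ([no_adjacent_triangles]).  A cuboid satisfies it, having no
    triangular face at all ([box_polytope]); a tetrahedron does not, since any
    two of its faces share an edge.

    Suppose that [Q] satisfies the invariant and arises from [P] by attaching
    a tetrahedron.  Types (i), (ii) and (v) produce two triangular faces with
    a common edge, so they are excluded at once.  In types (iii) and (iv) one
    face is identified, and a connectedness argument on segments ending at the
    apex [w] shows that the plane of that face cuts the convex set [Q] into
    exactly [P] and the tetrahedron ([convex_split]); hence [P] is again a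
    convex polytope.

    A face of [P] other than the identified one lies in a face of [Q], and if
    its plane misses [w] it is itself a face of [Q] ([cut_facet],
    [cut_facet_off_apex]).  So only a triangular face of [P] whose plane
    contains [w] could cause trouble.  Such a plane contains two vertices of
    the identified face ([cut_facet_at_apex]), together with the far ends of
    those edges that are prolonged to [w] through these vertices.
    - In type (iv) the face then has four extreme points, so that it is not a
      triangle ([truncated_side]).
    - In type (iii), let [v p q] be the identified face, [v] the vanishing
      vertex and [u] the far end of its prolonged edge.  The plane [p q w]
      meets [P] in the segment [p q] only, so the face contains [v] and, say,
      [p].  Then it is the triangle [u v p], and [u p w] is a triangular face
      of [Q], which shares the edge [p w] with the new face [p q w]; this
      contradicts the invariant for [Q] ([shortened_side]).
    Every triangular face of [P] other than the identified one is therefore a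
    triangular face of [Q] whose plane misses [w], so it contains no vanishing
    vertex.  In type (iv) it cannot share an edge with the identified face, and
    in type (iii) it could only share the edge [p q], being then adjacent to
    [p q w] in [Q].

    To link this with strata and connected components, [facesP] shows that the
    faces of a closed convex solid are its intersections with the supporting
    planes near some point of which the solid is a half-space, and
    [vertex_extreme] that the vertices of a polytope are extreme points. *)

Set Implicit Arguments.
Unset Strict Implicit.
Unset Printing Implicit Defensive.

Import Order.TTheory GRing.Theory Num.Theory.
Import numFieldNormedType.Exports.

Local Open Scope classical_set_scope.
Local Open Scope ring_scope.

Local Notation space R := 'rV[R]_3.

(** * Affine functions, half-spaces and neighbourhoods *)

Section Affine.
Variable R : realType.
Implicit Types (n : 'cV[R]_3) (g : 'cV[R]_3 * R) (x y z w d : space R) (A Q : set (space R)).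

(** The linear form with coefficient column [n]. *)
Definition lin n d : R := (d *m n) 0 0.

(** The affine function [x |-> lin n x + c] given by the pair [g = (n, c)]. *)
Definition ev g x : R := lin g.1 x + g.2.

(** The affine function with linear part [n] that vanishes at [x]. *)
Definition through n x : 'cV[R]_3 * R := (n, - lin n x).

Lemma linD n d e : lin n (d + e) = lin n d + lin n e.
Proof. by rewrite /lin mulmxDl mxE. Qed.

Lemma linZ n a d : lin n (a *: d) = a * lin n d.
Proof. by rewrite /lin -scalemxAl mxE. Qed.

Lemma linN n d : lin n (- d) = - lin n d.
Proof. by rewrite -scaleN1r linZ mulN1r. Qed.

Lemma lin0 n : lin n 0 = 0.
Proof. by rewrite -(scale0r 0) linZ mul0r. Qed.

Definition linE := (linD, linZ, linN, lin0).

Lemma linNn n d : lin (- n) d = - lin n d.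
Proof. by rewrite /lin mulmxN mxE. Qed.

Lemma lin_eq0 n d : lin n d = 0 <-> d *m n = 0.
Proof.
split=> [h|h]; last by rewrite /lin h mxE.
by apply/matrixP => i j; rewrite !ord1 [RHS]mxE.
Qed.

Lemma lin_surj n : n != 0 -> exists d, lin n d = 1.
Proof.
move=> n0; have [d d0] : exists d, lin n d != 0.
  apply: contrapT => H; move/eqP: n0; apply; apply/matrixP => i j.
  rewrite ord1 mxE; apply/eqP/negPn/negP => nij; apply: H; exists (delta_mx 0 i).
  by rewrite /lin -rowE mxE.
by exists ((lin n d)^-1 *: d); rewrite linZ mulVf.
Qed.

Lemma lin_bound n : exists2 C, 0 < C & forall d, `|lin n d| <= C * `|d|.
Proof.
exists (1 + \sum_i `|n i 0|) => [|d].
  by rewrite ltr_pwDl // sumr_ge0.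
rewrite /lin mxE; apply: (le_trans (ler_norm_sum _ _ _)).
rewrite mulrDl mul1r mulr_suml.
apply: le_trans (_ : \sum_i `|n i 0| * `|d| <= _); last by rewrite lerDr.
apply: ler_sum => i _; rewrite normrM mulrC ler_wpM2l //.
by rewrite [leRHS]/Num.norm/= mx_normrE; apply/bigmax_geP; right; exists (0, i).
Qed.

Lemma nearP x A : nbhs x A <-> exists2 e : R, 0 < e & forall d, `|d| < e -> A (x + d).
Proof.
have H : nbhs x A <-> nbhs_ball_ (ball_ Num.norm) x A := nbhs_normP x A.
apply: (iff_trans H); split=> -[e /= e0 He]; exists e => //.
  move=> d de.
  by apply: He => /=; rewrite opprD addNKr normrN.
move=> y /= de.
by rewrite -(subrKC x y); apply: He; rewrite distrC.
Qed.

Lemma near2P x (S : space R -> R -> Prop) :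
  (\forall y \near x & t \near (0 : R), S y t) <->
  exists2 e : R, 0 < e & forall d t, `|d| < e -> `|t| < e -> S (x + d) t.
Proof.
split.
  move=> [[U V] /= [/nearP [e1 e10 H1] /nbhs_ballP [e2 /= e20 H2]] H].
  exists (Num.min e1 e2); first by rewrite lt_min e10.
  move=> d t; rewrite !lt_min => /andP[d1 _] /andP[_ t2].
  by apply: (H (x + d, t)); split; [exact: H1 | apply: H2; rewrite /ball /= sub0r normrN].
move=> [e e0 H]; exists ([set y | `|y - x| < e], [set t : R | `|t| < e]) => /=.
  split; first by apply/nearP; exists e => // d /=; rewrite addrAC subrr add0r.
  by apply/nbhs_ballP; exists e => //= t; rewrite /ball /= sub0r normrN.
by move=> [y t] /= [h1 h2]; rewrite -(subrKC x y); apply: H.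
Qed.

Lemma evD g x d : ev g (x + d) = ev g x + lin g.1 d.
Proof. by rewrite /ev linD addrAC. Qed.

Lemma ev_through n x y : ev (through n x) y = lin n (y - x).
Proof. by rewrite /ev /through /= !linE. Qed.

Lemma ev_comb g a x y : ev g ((1 - a) *: x + a *: y) = (1 - a) * ev g x + a * ev g y.
Proof. by rewrite /ev !linE; ring. Qed.

Lemma ev_comb3 g (s t k : R) x y z : s + t + k = 1 ->
  ev g (s *: x + t *: y + k *: z) = s * ev g x + t * ev g y + k * ev g z.
Proof.
move=> stk; have sE : s = 1 - t - k by lra.
by rewrite /ev !linE sE; ring.
Qed.

Lemma ev_comb4 g (s t k m : R) x y z w : s + t + k + m = 1 ->
  ev g (s *: x + t *: y + k *: z + m *: w) =
  s * ev g x + t * ev g y + k * ev g z + m * ev g w.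
Proof.
move=> S; have sE : s = 1 - t - k - m by lra.
by rewrite /ev !linE sE; ring.
Qed.

Lemma ev_gt0_near g x : 0 < ev g x -> \forall y \near x, 0 < ev g y.
Proof.
move=> gx; have [C C0 HC] := lin_bound g.1; apply/nearP.
exists (ev g x / C); rewrite ?divr_gt0// => d; rewrite ltr_pdivlMr// mulrC => h.
by rewrite evD; have := le_lt_trans (HC d) h; rewrite ltr_norml => /andP[h1 _]; lra.
Qed.

(** The opposite affine function. *)
Definition neg g : 'cV[R]_3 * R := (- g.1, - g.2).

Lemma evN g x : ev (neg g) x = - ev g x.
Proof. by rewrite /ev /neg /= linNn opprD. Qed.

Lemma near_line A x d : nbhs x A ->
  exists2 t : R, 0 < t & forall s, `|s| <= t -> A (x + s *: d).
Proof.
move=> /nearP[e e0 He]; have d1 : 0 < `|d| + 1 by rewrite ltr_wpDl.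
exists (e / (`|d| + 1)); first by rewrite divr_gt0.
move=> s hs; apply: He; rewrite normrZ.
have : `|s| * (`|d| + 1) <= e by rewrite -ler_pdivlMr.
by have := normr_ge0 s; have [->|] := eqVneq s 0; rewrite ?normr0 ?mul0r // -normr_gt0; lra.
Qed.

Lemma near_translate A x d : nbhs x A -> exists2 e : R, 0 < e &
  forall d' t, `|d'| < e -> `|t| < e -> A (x + d') /\ A (x + d' + t *: d).
Proof.
move=> /nearP[e e0 He]; have d1 : 0 < `|d| + 1 by rewrite ltr_wpDl.
exists (Num.min (e / 2) (e / 2 / (`|d| + 1))); first by rewrite lt_min !divr_gt0.
move=> d' t; rewrite !lt_min => /andP[h1 _] /andP[_ h2].
split; first by apply: He; lra.
rewrite -addrA; apply: He; apply: (le_lt_trans (ler_normD _ _)); rewrite normrZ.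
have : `|t| * (`|d| + 1) < e / 2 by rewrite -ltr_pdivlMr.
have := normr_ge0 t; lra.
Qed.

Lemma closed_ev_ge0 g : closed [set x | 0 <= ev g x].
Proof.
rewrite -openC openE => x /= /negP; rewrite -ltNge => gx.
have : 0 < ev (neg g) x by rewrite evN oppr_gt0.
move/ev_gt0_near; apply: filterS => y; rewrite evN oppr_gt0 => h /=.
by apply/negP; rewrite -ltNge.
Qed.

(** The solution set of finitely many affine inequalities. *)
Definition halfspaces (L : seq ('cV[R]_3 * R)) : set (space R) :=
  [set x | forall g, g \in L -> 0 <= ev g x].

(** Convexity of a set. *)
Definition cvx A := forall x y t, A x -> A y -> 0 <= t <= 1 -> A ((1 - t) *: x + t *: y).

Lemma halfspaces_cvx L : cvx (halfspaces L).
Proof.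
move=> x y t Ax Ay /andP[t0 t1] g gL; rewrite ev_comb.
by rewrite addr_ge0 // mulr_ge0 ?subr_ge0 ?Ax ?Ay.
Qed.

Lemma halfspaces_closed L : closed (halfspaces L).
Proof.
have -> : halfspaces L = \bigcap_(g in [set` L]) [set x | 0 <= ev g x] by [].
by apply: closed_bigI => g _; exact: closed_ev_ge0.
Qed.

Lemma connected_path x y (a b : R) :
  connected ((fun t : R => (1 - t) *: x + t *: y) @` `[a, b]).
Proof.
apply: connected_continuous_connected; first exact: segment_connected.
apply: continuous_subspaceT => t; apply: cvgD.
  by apply: cvgZr_tmp; apply: cvgB; [exact: cvg_cst | exact: cvg_id].
by apply: cvgZr_tmp; exact: cvg_id.
Qed.

End Affine.

(** * Facets of convex solids *)

Section Facets.
Variable R : realType.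
Implicit Types (n : 'cV[R]_3) (g h : 'cV[R]_3 * R) (x y d : space R) (A Q : set (space R)).

(** The supporting half-space [0 <= ev g] of [Q] touches [Q] at [x], and [Q]
    coincides with it near [x]: so [x] is a relative interior point of the
    facet that [Q] has in the plane [ev g = 0]. *)
Definition facet_at Q g x :=
  [/\ g.1 != 0, forall y, Q y -> 0 <= ev g y, ev g x = 0
    & \forall y \near x, 0 <= ev g y -> Q y].

Lemma locally_constant_invariant A Q x d : nbhs x A ->
  (forall y, A y -> Q y) \/ (forall y, A y -> ~ Q y) -> locally_invariant Q x d.
Proof.
move=> /(near_translate d)[e e0 He] H; apply/near2P; exists e => // d' t h1 h2.
have [A1 A2] := He _ _ h1 h2.
by case: H => H; split=> // h; [exact: H|exact: H|case: (H _ A1)|case: (H _ A2)].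
Qed.

Lemma facet_mem Q g x : facet_at Q g x -> Q x.
Proof. by move=> [_ _ gx /nbhs_singleton]; apply; rewrite gx. Qed.

(** An affine function that is nonnegative on [Q] and vanishes at a relative
    interior point of a facet is a multiple of the equation of the facet. *)
Lemma facet_support Q g h x : facet_at Q g x ->
  (forall y, Q y -> 0 <= ev h y) -> ev h x = 0 ->
  exists k, forall y, ev h y = k * ev g y.
Proof.
move=> [g0 _ gx nx] hQ hx.
(* By scaling, the inclusion of half-spaces near [x] holds for all directions. *)
have cone d : 0 <= lin g.1 d -> 0 <= lin h.1 d.
  move=> gd; have [t t0 /(_ t)] := near_line d nx.
  rewrite (ger0_norm (ltW t0)) => /(_ (lexx _)); rewrite evD gx linZ add0r.
  move=> /(_ (mulr_ge0 (ltW t0) gd)) /hQ.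
  by rewrite evD hx linZ add0r (pmulr_rge0 _ t0).
have [d0 gd0] := lin_surj g0; exists (lin h.1 d0) => y.
set e := (y - x) - lin g.1 (y - x) *: d0.
have ge : lin g.1 e = 0 by rewrite /e linD linN linZ gd0; ring.
have he : lin h.1 e = 0.
  apply/eqP; rewrite eq_le cone ?ge// andbT -oppr_ge0 -linN cone// linN ge oppr0//.
have ye : y = x + (e + lin g.1 (y - x) *: d0) by rewrite /e subrK subrKC.
move: (lin g.1 (y - x)) ye => c ye; rewrite {}ye; move: e ge he => e ge he.
by rewrite !evD !linD !linZ ge he gx hx gd0; ring.
Qed.

Lemma facet_stratum Q g x : facet_at Q g x -> stratum Q 2 x.
Proof.
move=> [g0 gQ gx nx]; exists (kermx g.1); split.
  have r1 : \rank g.1 = 1%N.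
    by apply/eqP; rewrite eqn_leq rank_leq_col lt0n mxrank_eq0.
  by rewrite mxrank_ker r1.
move=> d; apply: (@iff_trans _ (lin g.1 d = 0)); last first.
  by rewrite lin_eq0; split => [h|/sub_kermxP]; first exact/sub_kermxP.
split.
  move=> /near2P[e e0 He]; apply/eqP/negPn/negP => gd.
  (* A short step from [x] against the sign of [lin g.1 d] leaves [Q]. *)
  pose s : R := e / 2 * - Num.sg (lin g.1 d).
  have se : `|s| < e.
    rewrite normrM normrN normr_sg gd mulr1 ger0_norm ?ltW ?divr_gt0//.
    by rewrite ltr_pdivrMr// ltr_pMr// ltr1n.
  have := He 0 s; rewrite normr0 addr0 => /(_ e0 se)[+ _].
  have Qx : Q x by move/nbhs_singleton: nx; apply; rewrite gx.
  move/(_ Qx)/gQ; rewrite evD gx linZ add0r /s mulrN mulNr -mulrA -normrEsg.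
  by rewrite oppr_ge0 leNgt mulr_gt0 ?divr_gt0 ?normr_gt0.
move=> gd; apply/near2P; have [e e0 He] := near_translate d nx.
exists e => // d' t h1 h2; have [H1 H2] := He _ _ h1 h2.
have E : ev g (x + d' + t *: d) = ev g (x + d') by rewrite evD linZ gd mulr0 addr0.
by split=> /gQ; rewrite ?E => ge0; [apply: H2; rewrite E|exact: H1].
Qed.

(** A convex set that contains a flat disc around [x] and a point [y0] on one
    side of the disc contains a half-ball around [x] on that side: the cone
    over the disc with apex [y0] does. *)
Lemma halfspace_spread Q n x y0 e : cvx Q -> 0 < e ->
  (forall d, `|d| < e -> lin n d = 0 -> Q (x + d)) -> Q y0 -> 0 < lin n (y0 - x) ->
  \forall y \near x, 0 <= lin n (y - x) -> Q y.
Proof.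
move=> cQ e0 disc Qy0 ny0; apply/nearP.
set c := lin n (y0 - x); have [C C0 HC] := lin_bound n.
(* The point [x + d] is written [(1 - s) (x + d') + s y0] with [d'] in the plane. *)
pose K := C / c; have K0 : 0 < K by rewrite divr_gt0.
have den : 0 < 1 + K * `|y0 - x| by rewrite ltr_pwDl// mulr_ge0// ltW.
exists (Num.min (2^-1 / K) (e / 2 / (1 + K * `|y0 - x|))).
  by rewrite lt_min !divr_gt0.
move=> d; rewrite lt_min => /andP[h1 h2]; rewrite addrAC subrr add0r => nd.
pose s := lin n d / c.
have s0 : 0 <= s by rewrite divr_ge0// ltW.
have sK : s <= K * `|d|.
  rewrite /s /K mulrAC ler_pM2r ?invr_gt0//; apply: le_trans (HC d); exact: ler_norm.
have s1 : s < 2^-1.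
  by apply: le_lt_trans sK _; rewrite mulrC -ltr_pdivlMr.
have s1' : 0 < 1 - s by lra.
pose d' := (1 - s)^-1 *: (d - s *: (y0 - x)).
have -> : x + d = (1 - s) *: (x + d') + s *: y0.
  rewrite /d' scalerDr scalerA mulfV ?lt0r_neq0// scale1r.
  by apply/matrixP => i j; rewrite !mxE; ring.
apply: cQ => //; last by rewrite s0; lra.
apply: disc; last by rewrite /d' linZ linD linN linZ -/c /s mulfVK ?lt0r_neq0// subrr mulr0.
rewrite /d' normrZ gtr0_norm ?invr_gt0// mulrC ltr_pdivrMr//.
have : `|d - s *: (y0 - x)| <= `|d| + s * `|y0 - x|.
  by apply: le_trans (ler_normB _ _) _; rewrite normrZ ger0_norm.
have : s * `|y0 - x| <= K * `|d| * `|y0 - x| by rewrite ler_wpM2r.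
have : `|d| + K * `|d| * `|y0 - x| < e / 2.
  by move: h2; rewrite ltr_pdivlMr//; congr (_ < _); ring.
have : e * 2^-1 < e * (1 - s) by rewrite ltr_pM2l//; lra.
lra.
Qed.

(** Conversely a point of the stratum of dimension 2 of a closed convex solid
    lies inside a facet.  The invariant directions span a plane, a small disc
    of which around [x] lies in [Q]; by [halfspace_spread] the set [Q] fills a
    half-ball on any side where it has points, so it has none on one side. *)
Lemma stratum_facet Q x y0 : cvx Q -> closed Q -> Q° y0 -> stratum Q 2 x ->
  exists g, facet_at Q g x.
Proof.
move=> cQ clQ iy0 [W [rW HW]].
have [n n0 Hn] : exists2 n : 'cV[R]_3, n != 0 & forall d, (d <= W)%MS <-> lin n d = 0.
  have : cokermx W != 0.
    by rewrite -mxrank_eq0 mxrank_coker rW.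
  have -> : (cokermx W != 0) = ~~ [forall j, col j (cokermx W) == 0].
    congr (~~ _); apply/eqP/forallP => [-> j|H]; first by apply/eqP/matrixP=> i k; rewrite !mxE.
    by apply/matrixP => i j; have /eqP/matrixP/(_ i 0) := H j; rewrite !mxE.
  rewrite negb_forall => /existsP[j nj]; exists (col j (cokermx W)) => // d.
  have sub : (W <= kermx (col j (cokermx W)))%MS.
    by apply/sub_kermxP; rewrite colE mulmxA mulmx_coker mul0mx.
  have r1 : \rank (col j (cokermx W)) = 1%N.
    by apply/eqP; rewrite eqn_leq rank_leq_col lt0n mxrank_eq0.
  have /eqmxP eqW : (W == kermx (col j (cokermx W)))%MS.
    by rewrite -(mxrank_leqif_eq sub) mxrank_ker r1 rW.
  by rewrite eqW lin_eq0; split => [/sub_kermxP|h]; last exact/sub_kermxP.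
have [d0 nd0] := lin_surj n0.
have notinv : ~ locally_invariant Q x d0.
  by move/HW/Hn; rewrite nd0 => /eqP; rewrite oner_eq0.
have notconst (A : set (space R)) : nbhs x A -> (forall y, A y -> Q y) \/ (forall y, A y -> ~ Q y) -> False.
  by move=> nA H; apply: notinv; exact: locally_constant_invariant nA H.
have Qx : Q x.
  apply: contrapT => nQx; apply: (notconst (~` Q)); last by right.
  by apply: open_nbhs_nbhs; split => //; rewrite openC.
(* The directions [pe i] span the plane; convexity turns three invariance
   radii into one radius for a disc. *)
have [e e0 disc] : exists2 e : R, 0 < e & forall d, `|d| < e -> lin n d = 0 -> Q (x + d).
  pose pe (i : 'I_3) : space R := delta_mx 0 i - lin n (delta_mx 0 i) *: d0.
  have npe i : lin n (pe i) = 0 by rewrite /pe linD linN linZ nd0; ring.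
  have inv i : exists2 e : R, 0 < e & forall t, `|t| < e -> Q (x + t *: pe i).
    have /near2P[e e0 He] := (HW (pe i)).2 ((Hn _).2 (npe i)).
    by exists e => // t te; have := He 0 t; rewrite normr0 addr0 => /(_ e0 te)[+ _]; apply.
  have [e_ e_0 He_] : exists2 e_ : 'I_3 -> R, forall i, 0 < e_ i & forall i t, `|t| < e_ i -> Q (x + t *: pe i).
    have /choice[e_ He_] : forall i, exists e : R, 0 < e /\ forall t, `|t| < e -> Q (x + t *: pe i).
      by move=> i; have [e ? ?] := inv i; exists e.
    by exists e_ => i; case: (He_ i).
  pose i0 : 'I_3 := 0; pose i1 : 'I_3 := 1; pose i2 : 'I_3 := 2%:R.
  exists (Num.min (e_ i0) (Num.min (e_ i1) (e_ i2)) / 3).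
    by rewrite divr_gt0// !lt_min !e_0.
  move=> d; rewrite ltr_pdivlMr// !lt_min => /and3P[h0 h1 h2] nd.
  have dE : d = d 0 i0 *: pe i0 + d 0 i1 *: pe i1 + d 0 i2 *: pe i2.
    have E : d = d 0 i0 *: delta_mx 0 i0 + d 0 i1 *: delta_mx 0 i1 + d 0 i2 *: delta_mx 0 i2.
      rewrite {1}(row_sum_delta d) !big_ord_recl big_ord0 addr0 addrA.
      have -> : lift ord0 ord0 = i1 by apply/val_inj.
      by have -> : lift ord0 (lift ord0 ord0) = i2 by apply/val_inj.
    rewrite /pe; move: (d 0 i0) (d 0 i1) (d 0 i2) E => a0 a1 a2 E.
    move: nd; rewrite E !linE => nd; rewrite -[LHS]subr0 -(scale0r d0) -nd.
    by apply/matrixP => i j; rewrite !mxE; ring.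
  have lec i : `|d 0 i| <= `|d|.
    by rewrite [leRHS]/Num.norm/= mx_normrE; apply/bigmax_geP; right; exists (0, i).
  have in3 i : `|d| * 3 < e_ i -> Q (x + (3 * d 0 i) *: pe i).
    move=> h; apply: He_; rewrite normrM ger0_norm// mulrC.
    by apply: le_lt_trans h; rewrite ler_pM2r.
  have Q12 := cQ _ _ (2^-1) (in3 _ h0) (in3 _ h1).
  have {}Q12 := Q12 ltac:(lra).
  have := cQ _ _ (3^-1) Q12 (in3 _ h2) ltac:(lra).
  rewrite [in X in _ -> Q X]dE; congr (Q _).
  apply/matrixP => i j; rewrite !mxE; lra.
have spread m y1 : (m = n \/ m = - n) -> Q y1 -> 0 < lin m (y1 - x) ->
    \forall y \near x, 0 <= lin m (y - x) -> Q y.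
  move=> hm Qy1 py1; apply: (@halfspace_spread Q m x y1 e) => // d de md.
  by apply: disc => //; case: hm md => ->; rewrite ?linNn => /eqP; rewrite ?oppr_eq0 => /eqP.
have oneside m : (m = n \/ m = - n) -> (exists2 y1, Q y1 & 0 < lin m (y1 - x)) ->
    facet_at Q (through m x) x.
  move=> hm [y1 Qy1 py1]; have nm := spread m y1 hm Qy1 py1; split.
  - by case: hm => -> /=; rewrite ?oppr_eq0.
  - move=> y Qy; rewrite ev_through leNgt; apply/negP => yneg.
    have nm' : \forall y \near x, 0 <= lin (- m) (y - x) -> Q y.
      apply: (spread (- m) y) => //; last by rewrite linNn oppr_gt0.
      by case: hm => ->; rewrite ?opprK; [right|left].
    apply: (notconst _ (filterI nm nm')); left => z /= [h1 h2].
    have [/h1//|h] := leP 0 (lin m (z - x)).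
    by apply: h2; rewrite linNn oppr_ge0 ltW.
  - by rewrite ev_through subrr lin0.
  - by apply: filterS nm => y; rewrite ev_through.
have Qy0 := interior_subset iy0.
have [y1 Qy1 ny1] : exists2 y1, Q y1 & lin n (y1 - x) != 0.
  have [h|h] := eqVneq (lin n (y0 - x)) 0; last by exists y0.
  have [t t0 /(_ t)] := near_line d0 iy0.
  rewrite (ger0_norm (ltW t0)) => /(_ (lexx _)) Qt; exists (y0 + t *: d0) => //.
  by rewrite addrAC linD h linZ nd0 mulr1 add0r lt0r_neq0.
have [h|h] := ltP 0 (lin n (y1 - x)).
  by exists (through n x); apply: oneside; [left|exists y1].
exists (through (- n) x); apply: oneside; first by right.
by exists y1; rewrite // linNn oppr_gt0 lt_neqAle ny1.
Qed.
End Facets.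

(** * Faces as connected components *)

Section FaceSets.
Variable R : realType.
Implicit Types (n : 'cV[R]_3) (g h : 'cV[R]_3 * R) (x y z d : space R) (A Q F : set (space R)).

Lemma ev_nonconst g x : g.1 != 0 -> exists y, ev g y != ev g x.
Proof.
move=> /lin_surj[d gd]; exists (x + d).
by rewrite evD gd -subr_eq0 addrAC subrr add0r oner_eq0.
Qed.

Lemma facet_same_plane Q g g' x y : facet_at Q g x -> facet_at Q g' y -> ev g y = 0 ->
  forall z, ev g z = 0 <-> ev g' z = 0.
Proof.
move=> [g0 gQ gx _] fy gy z.
have [k Hk] := facet_support fy gQ gy; rewrite Hk; split=> [/eqP|->]; last by rewrite mulr0.
rewrite mulf_eq0 => /orP[/eqP k0|/eqP//].
have [w] := ev_nonconst x g0; by rewrite !Hk k0 !mul0r eqxx.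
Qed.

Lemma facet_not_interior Q g x : facet_at Q g x -> ~ Q° x.
Proof.
move=> [/lin_surj[d gd] gQ gx _] ix; have [t t0 /(_ (- t))] := near_line d ix.
rewrite normrN (ger0_norm (ltW t0)) => /(_ (lexx _))/gQ.
by rewrite evD gx linZ gd add0r mulr1 oppr_ge0 leNgt t0.
Qed.

(** Moving from a relative interior point of a facet towards any of its points
    stays in its relative interior. *)
Lemma facet_toward Q g x z t : cvx Q -> facet_at Q g x -> Q z -> ev g z = 0 ->
  0 <= t < 1 -> facet_at Q g ((1 - t) *: x + t *: z).
Proof.
move=> cQ [g0 gQ gx /nearP[e e0 He]] Qz gz /andP[t0 t1]; split => //.
  by rewrite ev_comb gx gz !mulr0 addr0.
have t1' : 0 < 1 - t by rewrite subr_gt0.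
apply/nearP; exists (e * (1 - t)); first by rewrite mulr_gt0.
move=> d de; rewrite evD ev_comb gx gz !mulr0 !add0r => gd.
have -> : (1 - t) *: x + t *: z + d = (1 - t) *: (x + (1 - t)^-1 *: d) + t *: z.
  by rewrite scalerDr scalerA mulfV ?lt0r_neq0// scale1r addrAC.
apply: cQ => //; last by rewrite t0 ltW.
apply: He; first by rewrite normrZ gtr0_norm ?invr_gt0// mulrC ltr_pdivrMr.
by rewrite evD gx linZ add0r mulr_ge0 // invr_ge0 ltW.
Qed.

Section Solid.
Variable Q : set (space R).
Hypotheses (cQ : cvx Q) (clQ : closed Q) (iQ : exists x, Q° x).

Lemma stratum2_near g y : facet_at Q g y ->
  \forall z \near y, stratum Q 2 z -> ev g z = 0.
Proof.
move=> [g0 gQ gy ny]; have nn : nbhs y [set z | 0 <= ev g z -> Q z]° by exact: nbhs_interior.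
apply: filterS nn => z iz sz; have [x0 ix0] := iQ.
have [g' fz] := stratum_facet cQ clQ ix0 sz.
have Qz := facet_mem fz.
apply/eqP; rewrite eq_le gQ // andbT leNgt; apply/negP => gz.
apply: (facet_not_interior fz); have := ev_gt0_near gz.
by move: iz; rewrite /interior /= => iz gz'; apply: filterS2 iz gz' => w /= + /ltW; apply.
Qed.

(** The component of the stratum through [x] stays in the plane of the facet
    because that plane is relatively clopen in the stratum; it is dense in the
    facet because of the segments issued from [x]. *)
Lemma facet_component g x : facet_at Q g x ->
  closure (connected_component (stratum Q 2) x) = Q `&` [set y | ev g y = 0].
Proof.
move=> fx; apply/seteqP; split.
  have clK : closed (Q `&` [set y | ev g y = 0]).
    have -> : Q `&` [set y | ev g y = 0] = Q `&` [set y | 0 <= ev (neg g) y].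
      have [_ gQ _ _] := fx; apply/seteqP; split => y [Qy] /=.
        by rewrite evN => ->; rewrite oppr0.
      rewrite evN oppr_ge0 => gy; split => //; apply/eqP.
      by rewrite eq_le gy gQ.
    by apply: closedI => //; exact: closed_ev_ge0.
  rewrite [X in _ `<=` X]((closure_id _).1 clK); apply: closure_subset.
  move=> y [B [Bx Bs Bc] By].
  have BK : B `&` [set z | ev g z = 0] = B.
    apply: Bc.
    - by exists x; split => //=; case: fx.
    - exists [set z | stratum Q 2 z -> ev g z = 0]°; first exact: open_interior.
      apply/seteqP; split => z [Bz] /= gz; split => //; last first.
        exact: (interior_subset gz (Bs _ Bz)).
      have [x0 ix0] := iQ; have [g' fz] := stratum_facet cQ clQ ix0 (Bs _ Bz).
      apply: filterS (stratum2_near fz) => w H /H gw.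
      by apply/(facet_same_plane fx fz gz).
    - exists [set z | ev g z = 0] => //.
      have -> : [set z | ev g z = 0] = [set z | 0 <= ev g z] `&` [set z | 0 <= ev (neg g) z].
        apply/seteqP; split => z /=; rewrite evN oppr_ge0; first by move=> ->; rewrite lexx.
        by move=> [h1 h2]; apply/eqP; rewrite eq_le h1 h2.
      by apply: closedI => //; exact: closed_ev_ge0.
  have [x0 ix0] := iQ; have [g' fz] := stratum_facet cQ clQ ix0 (Bs _ By).
  by split; [exact: facet_mem fz | rewrite -BK in By; case: By].
move=> z [Qz gz] B Bz.
have [t t0 Ht] := near_line (x - z) Bz.
pose s := Num.min t 1; have s0 : 0 < s by rewrite /s lt_min t0 ltr01.
have st : s <= t by rewrite /s ge_min lexx.
have s1 : s <= 1 by rewrite /s ge_min lexx orbT.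
exists (z + s *: (x - z)); split; last by apply: Ht; rewrite ger0_norm // ltW.
pose f (r : R) : space R := (1 - r) *: x + r *: z.
have fE : z + s *: (x - z) = f (1 - s).
  by apply/matrixP => i j; rewrite !mxE; ring.
apply: (@connected_component_max _ _ (f @` `[0, 1 - s])).
- by exists 0; rewrite /= ?in_itv/= ?lexx ?subr_ge0 // /f subr0 scale1r scale0r addr0.
- move=> u [r /=]; rewrite in_itv/= => /andP[r0 r1] <-.
  apply: facet_stratum; apply: (facet_toward cQ fx Qz gz); rewrite r0; lra.
- exact: connected_path.
- by exists (1 - s); rewrite /= ?in_itv /= ?lexx ?subr_ge0 ?s1.
Qed.

Lemma facesP F : faces Q F <->
  exists g x, facet_at Q g x /\ F = Q `&` [set y | ev g y = 0].
Proof.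
split=> [[x sx <-]|[g [x [fx ->]]]].
  have [x0 ix0] := iQ; have [g fx] := stratum_facet cQ clQ ix0 sx.
  by exists g, x; rewrite (facet_component fx).
by exists x; [exact: facet_stratum fx | exact: facet_component fx].
Qed.

End Solid.
End FaceSets.

(** * Convex combinations, extreme points and barycentric coordinates *)

Section Coordinates.
Variable R : realType.
Implicit Types (n : 'cV[R]_3) (g h : 'cV[R]_3 * R) (a b c p q r u v w x y z d : space R) (A Q F : set (space R)).

Lemma segmentP p q x : segment p q x <->
  exists s t : R, [/\ 0 <= s, 0 <= t, s + t = 1 & x = s *: p + t *: q].
Proof.
split=> [[c [c0 c1 ->]]|[s [t [s0 t0 st ->]]]].
  exists (c ord0), (c (lift ord0 ord0)); split => //.
  - by rewrite -c1 !big_ord_recl big_ord0 addr0.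
  - by rewrite !big_ord_recl big_ord0 addr0.
exists (fun i => [:: s; t]`_i); split.
- by case=> -[|[|[|]]].
- by rewrite !big_ord_recl big_ord0 /= addr0.
- by rewrite !big_ord_recl big_ord0 /= addr0.
Qed.

Lemma triangleP p q r x : triangle p q r x <->
  exists s t k : R, [/\ 0 <= s, 0 <= t, 0 <= k, s + t + k = 1 & x = s *: p + t *: q + k *: r].
Proof.
split=> [[c [c0 c1 ->]]|[s [t [k [s0 t0 k0 st ->]]]]].
  exists (c ord0), (c (lift ord0 ord0)), (c (lift ord0 (lift ord0 ord0))); split => //.
  - by rewrite -c1 !big_ord_recl big_ord0 addr0 addrA.
  - by rewrite !big_ord_recl big_ord0 addr0 addrA.
exists (fun i => [:: s; t; k]`_i); split.
- by case=> -[|[|[|]]].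
- by rewrite !big_ord_recl big_ord0 /= addr0 addrA.
- by rewrite !big_ord_recl big_ord0 /= addr0 addrA.
Qed.

Lemma tetrahedronP p q r w x : tetrahedron p q r w x <->
  exists s t k m : R, [/\ 0 <= s, 0 <= t, 0 <= k, 0 <= m
    & s + t + k + m = 1 /\ x = s *: p + t *: q + k *: r + m *: w].
Proof.
split=> [[c [c0 c1 ->]]|[s [t [k [m [s0 t0 k0 m0 [st ->]]]]]]].
  exists (c ord0), (c (lift ord0 ord0)), (c (lift ord0 (lift ord0 ord0))),
    (c (lift ord0 (lift ord0 (lift ord0 ord0)))); split => //; split.
  - by rewrite -c1 !big_ord_recl big_ord0 addr0 !addrA.
  - by rewrite !big_ord_recl big_ord0 addr0 !addrA.
exists (fun i => [:: s; t; k; m]`_i); split.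
- by case=> -[|[|[|[|]]]].
- by rewrite !big_ord_recl big_ord0 /= addr0 !addrA.
- by rewrite !big_ord_recl big_ord0 /= addr0 !addrA.
Qed.

Lemma triangle_cvx p q r : cvx (triangle p q r).
Proof.
move=> x y m /triangleP[s [t [k [s0 t0 k0 stk ->]]]].
move=> /triangleP[s' [t' [k' [s0' t0' k0' stk' ->]]]] /andP[m0 m1].
apply/triangleP; exists ((1 - m) * s + m * s'), ((1 - m) * t + m * t'), ((1 - m) * k + m * k').
have m1' : 0 <= 1 - m by rewrite subr_ge0.
split; try by rewrite addr_ge0 // mulr_ge0.
  by transitivity ((1 - m) * (s + t + k) + m * (s' + t' + k')); [ring|rewrite stk stk'; ring].
by apply/matrixP => i j; rewrite !mxE; ring.
Qed.

Lemma triangle1 p q r : triangle p q r p.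
Proof. by apply/triangleP; exists 1, 0, 0; rewrite !scale0r scale1r !addr0 ler01 lexx. Qed.
Lemma triangle2 p q r : triangle p q r q.
Proof. by apply/triangleP; exists 0, 1, 0; rewrite !scale0r scale1r !addr0 !add0r ler01 lexx. Qed.
Lemma triangle3 p q r : triangle p q r r.
Proof. by apply/triangleP; exists 0, 0, 1; rewrite !scale0r scale1r !addr0 !add0r ler01 lexx. Qed.

Lemma triangle_sub A p q r : cvx A -> A p -> A q -> A r -> triangle p q r `<=` A.
Proof.
move=> cA Ap Aq Ar _ /triangleP[s [t [k [s0 t0 k0 stk ->]]]].
have [k1|k1] := eqVneq k 1.
  have [-> ->] : s = 0 /\ t = 0 by split; lra.
  by rewrite k1 !scale0r !add0r scale1r.
have k1' : 0 < 1 - k by rewrite subr_gt0 lt_neqAle k1; lra.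
have [u tE] : exists u : R, t = (1 - k) * u.
  by exists (t / (1 - k)); rewrite mulrCA mulfV ?lt0r_neq0// mulr1.
have -> : s *: p + t *: q + k *: r = (1 - k) *: ((1 - u) *: p + u *: q) + k *: r.
  have -> : s = (1 - k) * (1 - u) by lra.
  by rewrite tE scalerDr !scalerA.
apply: (cA) => //; last by lra.
apply: cA => //; nra.
Qed.

Lemma triangle_eq p q r a b c : triangle a b c p -> triangle a b c q -> triangle a b c r ->
  triangle p q r a -> triangle p q r b -> triangle p q r c -> triangle p q r = triangle a b c.
Proof. by move=> *; apply/seteqP; split; apply: triangle_sub => //; exact: triangle_cvx. Qed.

Lemma triangle_swap p q r : triangle p q r = triangle q p r.
Proof. by apply: triangle_eq; solve [exact: triangle1|exact: triangle2|exact: triangle3]. Qed.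

Lemma triangle_rot p q r : triangle p q r = triangle q r p.
Proof. by apply: triangle_eq; solve [exact: triangle1|exact: triangle2|exact: triangle3]. Qed.

(** [x] is a point of [Q] inside no nondegenerate segment of [Q]. *)
Definition extreme Q x :=
  Q x /\ forall y z, Q y -> Q z -> open_segment y z x -> y = z.

Lemma extreme_triangle Q a b c x : cvx Q -> Q a -> Q b -> Q c -> extreme Q x ->
  triangle a b c x -> x \in [:: a; b; c].
Proof.
move=> cQ Qa Qb Qc [Qx ex] /triangleP[s [t [k [s0 t0 k0 stk xE]]]].
have seg y z m : Q y -> Q z -> 0 <= m <= 1 -> x = (1 - m) *: y + m *: z -> x = y \/ x = z.
  move=> Qy Qz /andP[m0 m1] E.
  have [m0'|m0'] := eqVneq m 0; first by left; rewrite E m0' subr0 scale1r scale0r addr0.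
  have [m1'|m1'] := eqVneq m 1; first by right; rewrite E m1' subrr scale1r scale0r add0r.
  have yz : y = z by apply: ex => //; exists m; rewrite !lt_neqAle m0 m1 m1' eq_sym m0'.
  by left; rewrite E -yz -scalerDl subrK scale1r.
rewrite !inE; have [k1|k1] := eqVneq k 1.
  have [s0' t0'] : s = 0 /\ t = 0 by split; lra.
  by rewrite xE s0' t0' k1 !scale0r !add0r scale1r eqxx !orbT.
have k1' : 0 < 1 - k by rewrite subr_gt0 lt_neqAle k1; lra.
have [u tE] : exists u : R, t = (1 - k) * u.
  by exists (t / (1 - k)); rewrite mulrCA mulfV ?lt0r_neq0// mulr1.
have t1 : 0 <= u <= 1 by nra.
set y := (1 - u) *: a + u *: b.
have yE : x = (1 - k) *: y + k *: c.
  have sE : s = (1 - k) * (1 - u) by lra.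
  by rewrite xE /y sE tE scalerDr !scalerA.
have [||xy|->] := seg y c k _ Qc _ yE; [exact: cQ|lra| |by rewrite eqxx !orbT].
by have [->|->] := seg a b _ Qa Qb t1 xy; rewrite eqxx ?orbT.
Qed.

Lemma triangle_at_most_three Q a b c (s : seq (space R)) : cvx Q -> triangle a b c `<=` Q ->
  uniq s -> (forall x, x \in s -> extreme Q x /\ triangle a b c x) -> (size s <= 3)%N.
Proof.
move=> cQ sub us H; apply: (@uniq_leq_size _ s [:: a; b; c] us) => x /H[ex tx].
apply: extreme_triangle cQ _ _ _ ex tx; apply: sub;
  [exact: triangle1|exact: triangle2|exact: triangle3].
Qed.

Lemma triangle_three_extreme Q a b c p q r : cvx Q -> triangle a b c `<=` Q ->
  uniq [:: p; q; r] -> (forall x, x \in [:: p; q; r] -> extreme Q x /\ triangle a b c x) ->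
  [:: p; q; r] =i [:: a; b; c].
Proof.
move=> cQ sub us H; apply: (uniq_min_size us _ _).2 => // x /H[ex tx].
apply: extreme_triangle cQ _ _ _ ex tx; apply: sub;
  [exact: triangle1|exact: triangle2|exact: triangle3].
Qed.

(** If [x] is inside a segment of the polytope, the constraints active at [x]
    are constant along that segment, and the other ones hold near [x]; so the
    direction of the segment is a direction of local invariance. *)
Lemma vertex_extreme (L : seq ('cV[R]_3 * R)) x : vertices (halfspaces L) x -> extreme (halfspaces L) x.
Proof.
move=> [W [/eqP rW HW]]; move: rW; rewrite mxrank_eq0 => /eqP W0.
have noinv d : locally_invariant (halfspaces L) x d -> d = 0.
  by move/HW; rewrite W0 submx0 => /eqP.
split.
  apply: contrapT => nx; have /noinv/matrixP/(_ 0 0) : locally_invariant (halfspaces L) x (const_mx 1).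
    apply: (@locally_constant_invariant _ (~` halfspaces L)); last by right.
    by apply: open_nbhs_nbhs; split => //; rewrite openC; exact: halfspaces_closed.
  by rewrite !mxE => /eqP; rewrite oner_eq0.
move=> y z Ly Lz [t [/andP[t0 t1] xE]].
apply/eqP; rewrite eq_sym -subr_eq0; apply/eqP; apply: noinv.
have act g : g \in L -> 0 < ev g x \/ lin g.1 (z - y) = 0.
  move=> gL; have gy := Ly _ gL; have gz := Lz _ gL.
  have : 0 <= ev g x by rewrite xE ev_comb addr_ge0 // mulr_ge0 // ltW // subr_gt0.
  rewrite le_eqVlt => /orP[/eqP gx|]; [right|by left].
  move: gx; rewrite xE ev_comb => gx.
  have t1' : 0 < 1 - t by rewrite subr_gt0.
  have H1 := mulr_ge0 (ltW t0) gz; have H2 := mulr_ge0 (ltW t1') gy.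
  have gz' : ev g z = 0 by apply: (mulfI (lt0r_neq0 t0)); rewrite mulr0; lra.
  have gy' : ev g y = 0 by apply: (mulfI (lt0r_neq0 t1')); rewrite mulr0; lra.
  have -> : lin g.1 (z - y) = ev g z - ev g y by rewrite /ev !linE; ring.
  by rewrite gz' gy' subrr.
have loc g : g \in L -> exists2 e : R, 0 < e & forall d s, `|d| < e -> `|s| < e ->
    (0 <= ev g (x + d)) = (0 <= ev g (x + d + s *: (z - y))).
  move=> /act[gx|gzy]; last by exists 1 => // d s _ _; rewrite [in RHS]evD linZ gzy mulr0 addr0.
  have : locally_invariant [set u | 0 < ev g u] x (z - y).
    apply: (@locally_constant_invariant _ [set u | 0 < ev g u]); first exact: ev_gt0_near.
    by left.
  have [e1 e10 H1] := (nearP _ _).1 (ev_gt0_near gx).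
  move=> /near2P[e e0 He]; exists (Num.min e e1); first by rewrite lt_min e0.
  move=> d s; rewrite !lt_min => /andP[de de1] /andP[se _].
  have gd := H1 _ de1; have [+ _] := He d s de se => /(_ gd) /= gd'.
  by rewrite !ltW.
have [e e0 He] : exists2 e : R, 0 < e & forall g, g \in L -> forall d s, `|d| < e -> `|s| < e ->
    (0 <= ev g (x + d)) = (0 <= ev g (x + d + s *: (z - y))).
  elim: (L) loc => [|g L' IH] loc; first by exists 1.
  have [e1 e10 H1] := loc g (mem_head _ _).
  have [|e2 e20 H2] := IH; first by move=> g' g'L; apply: loc; rewrite inE g'L orbT.
  exists (Num.min e1 e2); first by rewrite lt_min e10.
  move=> g' + d s; rewrite !lt_min inE => /orP[/eqP ->|g'L] /andP[d1 d2] /andP[s1 s2].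
    exact: H1.
  exact: H2.
apply/near2P; exists e => // d s de se.
by split=> H g gL; [rewrite -He //; exact: H | rewrite (He g gL d s) //; exact: H].
Qed.

(** An edge comes with some endpoints; those of the given segment are the same. *)
Lemma edge_vertices Q p q : edges Q (segment p q) -> vertices Q p /\ vertices Q q.
Proof.
have end1 p' q' a b : segment a b = segment p' q' -> a = p' \/ a = q'.
  move=> E; have ha : segment p' q' a.
    by rewrite -E; apply/segmentP; exists 1, 0; rewrite scale1r scale0r !addr0 ler01 lexx.
  have hp : segment a b p'.
    by rewrite E; apply/segmentP; exists 1, 0; rewrite scale1r scale0r !addr0 ler01 lexx.
  have hq : segment a b q'.
    by rewrite E; apply/segmentP; exists 0, 1; rewrite scale1r scale0r !add0r ler01 lexx.
  have {hp} [s1 [t1 [s10 t10 st1 p'E]]] := (segmentP _ _ _).1 hp.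
  have {hq} [s2 [t2 [s20 t20 st2 q'E]]] := (segmentP _ _ _).1 hq.
  have {ha} [s [t [s0 t0 st aE]]] := (segmentP _ _ _).1 ha.
  have H : (s * t1 + t * t2) *: (b - a) = 0.
    have s1E : s1 = 1 - t1 by lra.
    have s2E : s2 = 1 - t2 by lra.
    have sE : s = 1 - t by lra.
    have -> : (s * t1 + t * t2) *: (b - a) = (s *: p' + t *: q') - a.
      by rewrite p'E q'E s1E s2E sE; apply/matrixP => i j; rewrite !mxE; ring.
    by rewrite -aE subrr.
  have [s0'|s0'] := eqVneq s 0.
    by right; rewrite aE s0' (_ : t = 1) ?scale0r ?add0r ?scale1r//; lra.
  have [t10'|t10'] := eqVneq t1 0.
    by left; rewrite p'E t10' (_ : s1 = 1) ?scale0r ?addr0 ?scale1r//; lra.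
  left; move/eqP: H; rewrite scaler_eq0 gt_eqF /=; last first.
    by rewrite ltr_pwDl ?mulr_ge0// mulr_gt0// lt_neqAle eq_sym ?s0' ?t10'.
  by rewrite subr_eq0 => /eqP ba; rewrite p'E ba -scalerDl st1 scale1r.
have segC a b : segment a b = segment b a.
  by apply/seteqP; split=> y /segmentP[s [t [s0 t0 st ->]]]; apply/segmentP; exists t, s; (split => //; [by rewrite addrC|exact: addrC]).
move=> [p' [q' [_ vp vq _ E]]]; split.
  by have [->|->] := end1 _ _ _ _ E.
by rewrite segC in E; have [->|->] := end1 _ _ _ _ E.
Qed.

Lemma dual_basis a b c : row_free (col_mx a (col_mx b c)) ->
  exists na nb nc, [/\ forall d, d = lin na d *: a + lin nb d *: b + lin nc d *: c,
    [/\ lin na a = 1, lin nb a = 0 & lin nc a = 0],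
    [/\ lin na b = 0, lin nb b = 1 & lin nc b = 0] &
    [/\ lin na c = 0, lin nb c = 0 & lin nc c = 1]].
Proof.
pose M : 'M[R]_3 := col_mx a (col_mx b c).
move=> Hfree; have uM : M \in unitmx by rewrite -row_free_unit.
pose i0 : 'I_3 := 0; pose i1 : 'I_3 := 1; pose i2 : 'I_3 := 2%:R.
have r0 : a = row i0 M.
  apply/rowP => j; rewrite mxE -(col_mxEu a (col_mx b c) 0 j); congr (col_mx _ _ _ _); exact: val_inj.
have r1 : b = row i1 M.
  apply/rowP => j; rewrite mxE -(col_mxEu b c 0 j) -(col_mxEd a (col_mx b c)); congr (col_mx _ _ _ _); exact: val_inj.
have r2 : c = row i2 M.
  apply/rowP => j; rewrite mxE -(col_mxEd b c 0 j) -(col_mxEd a (col_mx b c)); congr (col_mx _ _ _ _); exact: val_inj.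
have val i k : lin (col k (invmx M)) (row i M) = (i == k)%:R.
  transitivity ((M *m invmx M) i k); last by rewrite mulmxV // mxE.
  by rewrite /lin !mxE; apply: eq_bigr => j _; rewrite [row _ _ _ _]mxE [col _ _ _ _]mxE.
exists (col i0 (invmx M)), (col i1 (invmx M)), (col i2 (invmx M)); split.
- move=> d; rewrite [in LHS](_ : d = d *m invmx M *m M); last by rewrite mulmxKV.
  rewrite [LHS]mulmx_sum_row !big_ord_recl big_ord0 addr0 addrA.
  have E k : (d *m invmx M) 0 k = lin (col k (invmx M)) d by rewrite /lin !mxE; apply: eq_bigr => j _; rewrite [in RHS]mxE.
  have -> : lift ord0 ord0 = i1 by apply/val_inj.
  have -> : lift ord0 (lift ord0 ord0) = i2 by apply/val_inj.
  by rewrite !E -r1 -r2 -[row ord0 M]/(row i0 M) -r0.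
- by rewrite r0 !val.
- by rewrite r1 !val.
- by rewrite r2 !val.
Qed.

(** [lp], [lq], [lr] and [lw] are the barycentric coordinates with respect to
    [p], [q], [r] and [w]. *)
Record barycentric p q r w lp lq lr lw : Prop := Barycentric {
  bary_dec : forall y, y = ev lp y *: p + ev lq y *: q + ev lr y *: r + ev lw y *: w;
  bary_sum : forall y, ev lp y + ev lq y + ev lr y + ev lw y = 1;
  bary_p : [/\ ev lp p = 1, ev lq p = 0, ev lr p = 0 & ev lw p = 0];
  bary_q : [/\ ev lp q = 0, ev lq q = 1, ev lr q = 0 & ev lw q = 0];
  bary_r : [/\ ev lp r = 0, ev lq r = 0, ev lr r = 1 & ev lw r = 0];
  bary_w : [/\ ev lp w = 0, ev lq w = 0, ev lr w = 0 & ev lw w = 1] }.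

Lemma barycentricP p q r w : noncoplanar p q r w ->
  exists lp lq lr lw, barycentric p q r w lp lq lr lw.
Proof.
move=> /dual_basis[nq [nr [nw [dec [q1 q2 q3] [r1 r2 r3] [w1 w2 w3]]]]].
exists (- (nq + nr + nw), 1 + lin (nq + nr + nw) p), (through nq p), (through nr p), (through nw p).
have evp y : ev (- (nq + nr + nw), 1 + lin (nq + nr + nw) p) y
    = 1 - lin nq (y - p) - lin nr (y - p) - lin nw (y - p).
  by rewrite /ev /= linNn /lin !mulmxDr !mulmxBl !mxE; ring.
split => [y|y||||]; rewrite ?evp !ev_through ?subrr ?lin0 ?q1 ?q2 ?q3 ?r1 ?r2 ?r3 ?w1 ?w2 ?w3; try by split; ring.
  have E := dec (y - p).
  rewrite -[LHS](subrK p) {1}E.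
  by apply/matrixP => i j; rewrite !mxE; ring.
by ring.
Qed.

Lemma bary_ev p q r w lp lq lr lw g y : barycentric p q r w lp lq lr lw ->
  ev g y = ev lp y * ev g p + ev lq y * ev g q + ev lr y * ev g r + ev lw y * ev g w.
Proof.
move=> B; have S := bary_sum B y; rewrite {1}(bary_dec B y).
by rewrite ev_comb4.
Qed.

Lemma bary_tetrahedron p q r w lp lq lr lw y : barycentric p q r w lp lq lr lw ->
  tetrahedron p q r w y <-> [/\ 0 <= ev lp y, 0 <= ev lq y, 0 <= ev lr y & 0 <= ev lw y].
Proof.
move=> B; split; last first.
  move=> [h1 h2 h3 h4]; apply/tetrahedronP; exists (ev lp y), (ev lq y), (ev lr y), (ev lw y).
  by split => //; split; [exact: bary_sum B y|exact: bary_dec B y].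
move=> /tetrahedronP[s [t [k [m [s0 t0 k0 m0 [S ->]]]]]].
have [p1 p2 p3 p4] := bary_p B; have [q1 q2 q3 q4] := bary_q B.
have [r1 r2 r3 r4] := bary_r B; have [w1 w2 w3 w4] := bary_w B.
rewrite !(ev_comb4 _ _ _ _ _ S) p1 p2 p3 p4 q1 q2 q3 q4 r1 r2 r3 r4 w1 w2 w3 w4.
by rewrite !(mulr0, mulr1, addr0, add0r).
Qed.

Lemma bary_triangle p q r w lp lq lr lw y : barycentric p q r w lp lq lr lw ->
  triangle p q r y <-> tetrahedron p q r w y /\ ev lw y = 0.
Proof.
move=> B; split.
  move=> /triangleP[s [t [k [s0 t0 k0 S ->]]]]; split.
    by apply/tetrahedronP; exists s, t, k, 0; rewrite scale0r !addr0 lexx; split.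
  rewrite ev_comb3 //.
  by have [_ _ _ ->] := bary_p B; have [_ _ _ ->] := bary_q B; have [_ _ _ ->] := bary_r B; rewrite !mulr0 !addr0.
move=> [/(bary_tetrahedron y B)[h1 h2 h3 _] h4]; apply/triangleP.
exists (ev lp y), (ev lq y), (ev lr y); split => //.
  by have := bary_sum B y; rewrite h4 addr0.
by have := bary_dec B y; rewrite h4 scale0r addr0.
Qed.

Lemma bary_uniq p q r w lp lq lr lw : barycentric p q r w lp lq lr lw ->
  uniq [:: p; q; r].
Proof.
move=> B; have [p1 _ _ _] := bary_p B; have [q1 q2 _ _] := bary_q B.
have [r1 r2 _ _] := bary_r B.
rewrite /= !inE !negb_or !andbT; apply/andP; split; first (apply/andP; split); apply/eqP => F.
- by move: p1; rewrite F q1 => /esym/eqP; rewrite oner_eq0.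
- by move: p1; rewrite F r1 => /esym/eqP; rewrite oner_eq0.
- by move: q2; rewrite F r2 => /esym/eqP; rewrite oner_eq0.
Qed.

Lemma bary_rot p q r w lp lq lr lw :
  barycentric p q r w lp lq lr lw -> barycentric q r p w lq lr lp lw.
Proof.
move=> [dec S [? ? ? ?] [? ? ? ?] [? ? ? ?] [? ? ? ?]]; split => // y.
  by rewrite {1}(dec y); congr (_ + _); rewrite -addrA addrC.
by rewrite -[RHS](S y); congr (_ + _); rewrite -[RHS]addrA [RHS]addrC.
Qed.

Lemma bary_swap p q r w lp lq lr lw :
  barycentric p q r w lp lq lr lw -> barycentric q p r w lq lp lr lw.
Proof.
move=> [dec S [? ? ? ?] [? ? ? ?] [? ? ? ?] [? ? ? ?]]; split => // y.
  by rewrite {1}(dec y); congr (_ + _ + _); rewrite addrC.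
by rewrite -[RHS](S y); congr (_ + _ + _); rewrite addrC.
Qed.

Lemma bary_swap_apex p q r w lp lq lr lw :
  barycentric p q r w lp lq lr lw -> barycentric p q w r lp lq lw lr.
Proof.
move=> [dec S [? ? ? ?] [? ? ? ?] [? ? ? ?] [? ? ? ?]]; split => // y.
  by rewrite {1}(dec y) addrAC.
by rewrite addrAC.
Qed.

End Coordinates.

(** * Cutting a tetrahedron off a convex polytope *)

Section Cuts.
Variable R : realType.
Implicit Types (g h : 'cV[R]_3 * R) (a b c p q r u v w x y z d : space R) (P Q F : set (space R)).

(** Convex polytope with nonempty interior. *)
Definition polytope Q := (exists L, Q = halfspaces L) /\ exists x, Q° x.

(** No two distinct triangular faces share an edge [a b]. *)
Definition no_adjacent_triangles Q := forall a b c d,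
  faces Q (triangle a b c) -> faces Q (triangle a b d) -> triangle a b c = triangle a b d.

Lemma polytope_cvx Q : polytope Q -> cvx Q.
Proof. by move=> [[L ->] _]; exact: halfspaces_cvx. Qed.

Lemma polytope_closed Q : polytope Q -> closed Q.
Proof. by move=> [[L ->] _]; exact: halfspaces_closed. Qed.

Lemma polytope_vertex Q x : polytope Q -> vertices Q x -> extreme Q x.
Proof. by move=> [[L ->] _]; exact: vertex_extreme. Qed.

Lemma polytope_faces Q F : polytope Q -> faces Q F <->
  exists g x, facet_at Q g x /\ F = Q `&` [set y | ev g y = 0].
Proof. by move=> pQ; apply: facesP (polytope_cvx pQ) (polytope_closed pQ) pQ.2 F. Qed.

Lemma polyhedron_interior P : polyhedron P -> exists x, P° x.
Proof.
move=> [[[x Px] _ PE _] _]; apply: contrapT => nint.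
have P0 : P° = set0 by apply/seteqP; split => // y Py; apply: nint; exists y.
by move: Px; rewrite PE P0 closure0.
Qed.

Lemma polyhedron_closed P : polyhedron P -> closed P.
Proof. by move=> [[_ _ -> _] _]; exact: closed_closure. Qed.

(** The plane through [p], [q] and [r] cuts the polytope [Q] into the polytope
    [P] and the tetrahedron [p q r w].  The barycentric coordinate [lw] of the
    apex serves as equation of the plane: it is positive on the side of [w]. *)
Record tetra_cut P Q p q r w lp lq lr lw : Prop := Cut {
  cut_bary : barycentric p q r w lp lq lr lw;
  cut_polytope : polytope P;
  cut_whole : polytope Q;
  cut_below : forall y, P y <-> Q y /\ ev lw y <= 0;
  cut_above : forall y, tetrahedron p q r w y <-> Q y /\ 0 <= ev lw y }.

(** A point of [Q] strictly on the side of [w] lies in the tetrahedron [T]: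
    otherwise the segment from it to [w], which does not meet the plane, would
    be split by the disjoint closed sets [P] and [T]. *)
Lemma convex_split P Q p q r w lp lq lr lw :
  cvx Q -> closed P -> barycentric p q r w lp lq lr lw ->
  P `&` tetrahedron p q r w = triangle p q r -> Q = P `|` tetrahedron p q r w ->
  (forall y, P y <-> Q y /\ ev lw y <= 0) /\
  (forall y, tetrahedron p q r w y <-> Q y /\ 0 <= ev lw y).
Proof.
move=> cQ clP B PT QE; set T := tetrahedron p q r w in PT QE *.
have [w1 w2 w3 w4] := bary_w B.
have Tw : T w by apply/(bary_tetrahedron w B); rewrite w1 w2 w3 w4 lexx ler01.
have PTw y : P y -> T y -> ev lw y = 0.
  by move=> Py Ty; have : triangle p q r y by [rewrite -PT]; case/(bary_triangle y B).
have clT : closed T.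
  have -> : T = halfspaces [:: lp; lq; lr; lw]; last exact: halfspaces_closed.
  apply/seteqP; split => y.
    move/(bary_tetrahedron y B) => [h1 h2 h3 h4] g.
    by rewrite !inE => /or4P[] /eqP ->.
  by move=> H; apply/(bary_tetrahedron y B); split; apply: H; rewrite !inE eqxx ?orbT.
have QT y : T y -> Q y by rewrite QE; right.
have QP y : P y -> Q y by rewrite QE; left.
have above y : Q y -> 0 < ev lw y -> T y.
  move=> Qy hy; apply: contrapT => nTy.
  have Py : P y by move: Qy; rewrite QE => -[].
  pose f (t : R) : space R := (1 - t) *: y + t *: w.
  have fh t : 0 <= t <= 1 -> 0 < ev lw (f t).
    by move=> /andP[t0 t1]; rewrite ev_comb w4; nra.
  have cf : connected (f @` `[0, 1]) by exact: connected_path.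
  have E : (f @` `[0, 1]) `&` P = f @` `[0, 1].
    apply: cf.
    - by exists y; split => //; exists 0; rewrite /= ?in_itv/= ?lexx ?ler01// /f subr0 scale1r scale0r addr0.
    - exists (~` T); first by rewrite openC.
      apply/seteqP; split => z [[t]]; rewrite /= in_itv/= => t01 <-.
        move=> Pz; split; first by exists t; rewrite //= in_itv.
        by move=> Tz; have := fh _ t01; rewrite (PTw _ Pz Tz) ltxx.
      move=> nT; split; first by exists t; rewrite //= in_itv.
      have : Q (f t) by apply: cQ => //; exact: QT.
      by rewrite QE => -[].
    - by exists P.
  have Pw : P w.
    have : (f @` `[0, 1]) w.
      by exists 1; rewrite /= ?in_itv/= ?lexx ?ler01// /f subrr scale1r scale0r add0r.
    by rewrite -E => -[].
  by have := PTw _ Pw Tw; rewrite w4 => /eqP; rewrite oner_eq0.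
have Tge y : T y -> 0 <= ev lw y by case/(bary_tetrahedron y B).
split=> y; split.
- move=> Py; split; first exact: QP.
  rewrite leNgt; apply/negP => hy.
  by have := PTw _ Py (above _ (QP _ Py) hy); move: hy => /[swap] ->; rewrite ltxx.
- move=> [Qy hy]; move: (Qy); rewrite QE => -[//|Ty].
  have : triangle p q r y.
    by apply/(bary_triangle y B); split => //; apply/eqP; rewrite eq_le hy Tge.
  by rewrite -PT => -[].
- by move=> Ty; split; [exact: QT|exact: Tge].
- move=> [Qy hy].
  have : T ((1 - 2^-1) *: y + 2^-1 *: w).
    apply: above; first by apply: cQ => //; [exact: QT|lra].
    by rewrite ev_comb w4; lra.
  move/(bary_tetrahedron _ B); rewrite !ev_comb w1 w2 w3 !mulr0 !addr0.
  have h2 : 0 < 1 - 2^-1 :> R by lra.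
  rewrite !(pmulr_rge0 _ h2) => -[h3 h4 h5 _].
  by apply/(bary_tetrahedron y B).
Qed.

Lemma one_face_cut P Q p q r w : polytope Q -> one_face_attachment P Q p q r w ->
  exists lp lq lr lw, tetra_cut P Q p q r w lp lq lr lw.
Proof.
move=> pQ [[hP hQ npqrw] [_ PT QE]].
have [lp [lq [lr [lw B]]]] := barycentricP npqrw.
have [HP HT] := convex_split (polytope_cvx pQ) (polyhedron_closed hP) B PT QE.
exists lp, lq, lr, lw; split => //; split; last exact: polyhedron_interior.
have [[L QL] _] := pQ; exists (neg lw :: L); apply/seteqP; split => y.
  move=> /HP[Qy hy] g; rewrite inE => /orP[/eqP ->|gL]; first by rewrite evN oppr_ge0.
  by rewrite QL in Qy; exact: Qy.
move=> H; apply/HP; split.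
  by rewrite QL => g gL; apply: H; rewrite inE gL orbT.
by rewrite -oppr_ge0 -evN; apply: H; rewrite inE eqxx.
Qed.

Lemma cut_rot P Q p q r w lp lq lr lw :
  tetra_cut P Q p q r w lp lq lr lw -> tetra_cut P Q q r p w lq lr lp lw.
Proof.
move=> [B pP pQ HP HT]; have B' := bary_rot B; split => // y.
by rewrite -HT (bary_tetrahedron y B) (bary_tetrahedron y B'); split => -[].
Qed.

Lemma cut_swap P Q p q r w lp lq lr lw :
  tetra_cut P Q p q r w lp lq lr lw -> tetra_cut P Q q p r w lq lp lr lw.
Proof.
move=> [B pP pQ HP HT]; have B' := bary_swap B; split => // y.
by rewrite -HT (bary_tetrahedron y B) (bary_tetrahedron y B'); split => -[].
Qed.

(** [Q] lies in the cone with apex [w] over the triangle [p q r]. *)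
Lemma cut_cone P Q p q r w lp lq lr lw y : tetra_cut P Q p q r w lp lq lr lw ->
  Q y -> [/\ 0 <= ev lp y, 0 <= ev lq y & 0 <= ev lr y].
Proof.
move=> [B pP pQ HP HT] Qy; have [w1 w2 w3 w4] := bary_w B.
have [hy|hy] := leP 0 (ev lw y).
  have : tetrahedron p q r w y by apply/HT.
  by case/(bary_tetrahedron y B).
(* This is the ratio at which the segment from [w] to [y] crosses the plane. *)
pose s := (1 - ev lw y)^-1.
have h1 : 0 < 1 - ev lw y by lra.
have s0 : 0 < s by rewrite invr_gt0.
have s1 : s * (1 - ev lw y) = 1 by rewrite mulVf ?lt0r_neq0.
have s1' : s <= 1 by nra.
have Qw : Q w by apply: ((HT w).1 _).1; apply/(bary_tetrahedron w B); rewrite w1 w2 w3 w4 lexx ler01.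
have : tetrahedron p q r w ((1 - s) *: w + s *: y).
  apply/HT; split; first by apply: (polytope_cvx pQ) => //; rewrite ltW.
  by rewrite ev_comb w4; lra.
move/(bary_tetrahedron _ B); rewrite !ev_comb w1 w2 w3 !mulr0 !add0r.
by rewrite !(pmulr_rge0 _ s0) => -[].
Qed.

Lemma cut_apex P Q p q r w lp lq lr lw : tetra_cut P Q p q r w lp lq lr lw ->
  [/\ Q p, Q q, Q r & Q w].
Proof.
move=> [B pP pQ HP HT]; have H g := bary_ev g _ B.
have T y : 0 <= ev lp y -> 0 <= ev lq y -> 0 <= ev lr y -> 0 <= ev lw y -> Q y.
  by move=> *; apply: ((HT y).1 _).1; apply/(bary_tetrahedron y B).
have [p1 p2 p3 p4] := bary_p B; have [q1 q2 q3 q4] := bary_q B.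
have [r1 r2 r3 r4] := bary_r B; have [w1 w2 w3 w4] := bary_w B.
by split; apply: T; rewrite ?p1 ?p2 ?p3 ?p4 ?q1 ?q2 ?q3 ?q4 ?r1 ?r2 ?r3 ?r4 ?w1 ?w2 ?w3 ?w4.
Qed.

Lemma cut_triangle P Q p q r w lp lq lr lw y : tetra_cut P Q p q r w lp lq lr lw ->
  triangle p q r y <-> Q y /\ ev lw y = 0.
Proof.
move=> [B pP pQ HP HT]; rewrite (bary_triangle y B) HT.
by split=> [[[? ?] ?]|[? h]] //; rewrite h lexx.
Qed.

(** A facet of [P] other than the cut is supported by a facet plane of [Q]. *)
Lemma cut_facet P Q p q r w lp lq lr lw g x : tetra_cut P Q p q r w lp lq lr lw ->
  facet_at P g x -> P `&` [set y | ev g y = 0] = triangle p q r \/ facet_at Q g x.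
Proof.
move=> C fx; have [B pP pQ HP HT] := C; have [g0 gP gx nx] := fx.
have Px := facet_mem fx; have [Qx hx] := (HP x).1 Px.
have [hx0|hx0] := eqVneq (ev lw x) 0.
  left; have [||k Hk] := @facet_support _ P g (neg lw) x fx.
  - by move=> y /HP[_]; rewrite evN oppr_ge0.
  - by rewrite evN hx0 oppr0.
  have k0 : k != 0.
    apply/eqP => k0; have := Hk w; rewrite k0 mul0r evN.
    by have [_ _ _ ->] := bary_w B => /eqP; rewrite oppr_eq0 oner_eq0.
  have gh y : ev g y = 0 <-> ev lw y = 0.
    have := Hk y; rewrite evN => E; split => [gy|hy].
      by move: E; rewrite gy mulr0 => /eqP; rewrite oppr_eq0 => /eqP.
    by move: E; rewrite hy oppr0 => /esym/eqP; rewrite mulf_eq0 (negbTE k0) => /eqP.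
  apply/seteqP; split => y.
    by move=> [/HP[Qy _] /gh hy]; apply/(cut_triangle y C).
  move/(cut_triangle y C) => [Qy hy]; split; last exact/gh.
  by apply/HP; rewrite hy lexx.
right; have hx' : 0 < ev (neg lw) x by rewrite evN oppr_gt0 lt_neqAle hx0.
split => //; last by apply: filterS nx => y H /H /HP[].
move=> z Qz; rewrite leNgt; apply/negP => gz.
have nh : nbhs x [set y | 0 < ev (neg lw) y] by exact: ev_gt0_near.
have [t t0 Ht] := near_line (z - x) nh.
pose s := Num.min t 1; have s0 : 0 < s by rewrite /s lt_min t0 ltr01.
have st : s <= t by rewrite /s ge_min lexx.
have s1 : s <= 1 by rewrite /s ge_min lexx orbT.
have /Ht /= : `|s| <= t by rewrite ger0_norm // ltW.
have -> : x + s *: (z - x) = (1 - s) *: x + s *: z.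
  by apply/matrixP => i j; rewrite !mxE; ring.
rewrite evN oppr_gt0 => /ltW hs.
have /gP : P ((1 - s) *: x + s *: z).
  by apply/HP; split => //; apply: (polytope_cvx pQ) => //; rewrite ltW.
by rewrite ev_comb gx mulr0 add0r pmulr_rge0 // leNgt gz.
Qed.

(** A facet of [Q] whose plane misses the apex is untouched by the cut. *)
Lemma cut_facet_off_apex P Q p q r w lp lq lr lw g x : tetra_cut P Q p q r w lp lq lr lw ->
  facet_at Q g x -> ev g w != 0 -> Q `&` [set y | ev g y = 0] = P `&` [set y | ev g y = 0].
Proof.
move=> C [_ gQ _ _] gw; have [B pP pQ HP HT] := C.
have [Qp Qq Qr Qw] := cut_apex C.
apply/seteqP; split => y [Qy /= gy]; split => //; last by case/HP: Qy.
apply/HP; split => //; rewrite leNgt; apply/negP => hy.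
have [h1 h2 h3] := cut_cone C Qy.
have := bary_ev g y B; rewrite gy.
have := mulr_ge0 h1 (gQ _ Qp); have := mulr_ge0 h2 (gQ _ Qq); have := mulr_ge0 h3 (gQ _ Qr).
have : 0 < ev lw y * ev g w by rewrite mulr_gt0 // lt_neqAle eq_sym gw gQ.
lra.
Qed.

(** A facet plane of [Q] through [w] that misses [p] is the plane [q r w]. *)
Lemma cut_facet_at_apex P Q p q r w lp lq lr lw g x : tetra_cut P Q p q r w lp lq lr lw ->
  facet_at Q g x -> ev g w = 0 -> ev g p != 0 ->
  exists2 k, k != 0 & forall y, ev lp y = k * ev g y.
Proof.
move=> C fx gw gp; have [g0 gQ gx nx] := fx; have [B pP pQ HP HT] := C.
have [Qp Qq Qr Qw] := cut_apex C.
have [h1 h2 h3] := cut_cone C (facet_mem fx).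
have [||k Hk] := @facet_support _ Q g lp x fx.
- by move=> y Qy; have [] := cut_cone C Qy.
- have := bary_ev g x B; rewrite gx gw mulr0 addr0.
  have := mulr_ge0 h1 (gQ _ Qp); have := mulr_ge0 h2 (gQ _ Qq); have := mulr_ge0 h3 (gQ _ Qr).
  move=> H1 H2 H3 H4; have : ev lp x * ev g p = 0 by lra.
  by move/eqP; rewrite mulf_eq0 (negbTE gp) orbF => /eqP.
exists k => //; apply/eqP => k0; have := Hk p; rewrite k0 mul0r.
by have [-> _ _ _] := bary_p B => /eqP; rewrite oner_eq0.
Qed.

Lemma open_segment_ev g u w v : open_segment u w v -> 0 <= ev g u -> 0 <= ev g w ->
  ev g v = 0 -> ev g u = 0 /\ ev g w = 0.
Proof.
move=> [t [/andP[t0 t1] ->]] gu gw; rewrite ev_comb => E.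
have t1' : 0 < 1 - t by rewrite subr_gt0.
have H1 := mulr_ge0 (ltW t0) gw; have H2 := mulr_ge0 (ltW t1') gu.
split; [apply: (mulfI (lt0r_neq0 t1'))|apply: (mulfI (lt0r_neq0 t0))]; rewrite mulr0; lra.
Qed.

Lemma prolonged_below P Q p q r w lp lq lr lw u : tetra_cut P Q p q r w lp lq lr lw ->
  open_segment u w p -> ev lw u < 0.
Proof.
move=> [B pP pQ HP HT] [t [/andP[t0 t1] pE]].
have [_ _ _ p4] := bary_p B; have [_ _ _ w4] := bary_w B.
have : 0 < 1 - t by rewrite subr_gt0.
by move: p4; rewrite pE ev_comb w4; nra.
Qed.

(** Passing from [Q] to [P] keeps the invariant as soon as no triangular facet
    of [P] has a plane through [w], and no triangular face common to [P] and
    [Q] is adjacent to [p q r].  For the latter such a face may be assumed to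
    avoid [w] and every point strictly between [w] and a point of [Q]. *)
Lemma no_adjacent_triangles_cut P Q p q r w lp lq lr lw : tetra_cut P Q p q r w lp lq lr lw ->
  (forall g x a b c, facet_at P g x -> facet_at Q g x ->
     P `&` [set y | ev g y = 0] = triangle a b c -> ev g w != 0) ->
  (forall a b c d, triangle a b c = triangle p q r ->
     faces Q (triangle a b d) -> ~ triangle a b d w ->
     (forall u v, Q u -> open_segment u w v -> ~ triangle a b d v) -> False) ->
  no_adjacent_triangles Q -> no_adjacent_triangles P.
Proof.
move=> C Hw Hadj nQ; have [B pP pQ HP HT] := C.
have away a b c : faces P (triangle a b c) -> triangle a b c = triangle p q r \/
    [/\ faces Q (triangle a b c), ~ triangle a b c w &
       forall u v, Q u -> open_segment u w v -> ~ triangle a b c v].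
  move=> /(polytope_faces _ pP)[g [x [fx FE]]].
  have [<-|fQ] := cut_facet C fx; [by left|right].
  have gw := Hw g x a b c fx fQ (esym FE).
  have FQ : triangle a b c = Q `&` [set y | ev g y = 0].
    by rewrite FE (cut_facet_off_apex C fQ gw).
  split; first by apply/(polytope_faces _ pQ); exists g, x.
    by rewrite FQ => -[_ /= h]; rewrite h eqxx in gw.
  move=> u v Qu uwv; rewrite FQ => -[_ /= gv].
  have [_ gQ _ _] := fQ; have [_ _ _ Qw] := cut_apex C.
  have [_ h] := open_segment_ev uwv (gQ _ Qu) (gQ _ Qw) gv.
  by rewrite h eqxx in gw.
move=> a b c d /away[Ec|[Fc wc vc]] /away[Ed|[Fd wd vd]].
- by rewrite Ec Ed.
- by case: (Hadj a b c d Ec Fd wd vd).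
- by case: (Hadj a b d c Ed Fc wc vc).
- exact: nQ.
Qed.

(** When the edges from [u] and [u'] are prolonged through [p] and [q] to [w],
    the face of [P] in a facet plane of [Q] through [p] and [q] has the four
    extreme points [p], [q], [u] and [u'], so that it is not a triangle. *)
Lemma truncated_side P Q p q r w lp lq lr lw g x a b c u u' : tetra_cut P Q p q r w lp lq lr lw ->
  extreme P p -> extreme P q -> extreme P u -> extreme P u' ->
  open_segment u w p -> open_segment u' w q ->
  facet_at Q g x -> P `&` [set y | ev g y = 0] = triangle a b c ->
  ev g p = 0 -> ev g q = 0 -> False.
Proof.
move=> C ep eq eu eu' up uq [g0 gQ gx _] FE gp gq.
have [B pP pQ HP HT] := C; have [Qp Qq Qr Qw] := cut_apex C.
have Qu : Q u by case/HP: (eu.1).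
have Qu' : Q u' by case/HP: (eu'.1).
have [gu gw] := open_segment_ev up (gQ _ Qu) (gQ _ Qw) gp.
have [gu' _] := open_segment_ev uq (gQ _ Qu') (gQ _ Qw) gq.
have hu := prolonged_below C up; have hu' := prolonged_below (cut_swap C) uq.
have [p1 p2 p3 p4] := bary_p B; have [q1 q2 q3 q4] := bary_q B; have [w1 _ _ w4] := bary_w B.
have [Pp Pq Pu Pu'] : [/\ P p, P q, P u & P u'].
  by split; [case: ep|case: eq|case: eu|case: eu'].
suff : (size [:: p; q; u; u'] <= 3)%N by [].
apply: (@triangle_at_most_three _ P a b c _ (polytope_cvx pP)).
- by rewrite -FE => y [].
- rewrite /= !inE !negb_or !andbT; apply/and3P; split.
  + apply/and3P; split; apply/eqP => E.
    * by move: p1; rewrite E q1 => /esym/eqP; rewrite oner_eq0.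
    * by move: hu; rewrite -E p4 ltxx.
    * by move: hu'; rewrite -E p4 ltxx.
  + apply/andP; split; apply/eqP => E.
    * by move: hu; rewrite -E q4 ltxx.
    * by move: hu'; rewrite -E q4 ltxx.
  apply/eqP => E; move: up uq; rewrite -E => -[t [/andP[t0 t1] pE]] [s [/andP[s0 s1] qE]].
  move: p1 q1; rewrite pE qE !ev_comb w1 !mulr0 !addr0 => H1 /eqP.
  rewrite mulf_eq0 subr_eq0 eq_sym lt_eqF //= => /eqP H2.
  by move: H1; rewrite H2 mulr0 => /esym/eqP; rewrite oner_eq0.
- by move=> y; rewrite -FE !inE => /or4P[] /eqP ->; split.
Qed.

Lemma cut_triangle_vertices P Q p q r w lp lq lr lw a b c :
  tetra_cut P Q p q r w lp lq lr lw -> [/\ extreme P p, extreme P q & extreme P r] ->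
  triangle a b c = triangle p q r -> [:: p; q; r] =i [:: a; b; c].
Proof.
move=> C [ep eq er] E; have [B pP pQ HP HT] := C.
apply: (triangle_three_extreme (polytope_cvx pP) _ (bary_uniq B)).
  by rewrite E => y /(cut_triangle y C)[Qy hy]; apply/HP; rewrite hy.
move=> y; rewrite E !inE => /or3P[] /eqP ->; split => //.
- exact: triangle1.
- exact: triangle2.
- exact: triangle3.
Qed.

(** Undoing an attachment of type (iv) keeps the invariant. *)
Lemma truncation_step P Q p q r w lp lq lr lw u1 u2 u3 :
  tetra_cut P Q p q r w lp lq lr lw ->
  [/\ extreme P p, extreme P q & extreme P r] ->
  [/\ extreme P u1, extreme P u2 & extreme P u3] ->
  [/\ open_segment u1 w p, open_segment u2 w q & open_segment u3 w r] ->
  no_adjacent_triangles Q -> no_adjacent_triangles P.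
Proof.
move=> C [ep eq er] [e1 e2 e3] [s1 s2 s3]; have [B pP pQ HP HT] := C.
have [Qp Qq Qr Qw] := cut_apex C.
apply: (no_adjacent_triangles_cut C).
  move=> g x a b c _ fQ FE; apply/eqP => gw.
  have [gp|gp] := eqVneq (ev g p) 0; last first.
    have [k k0 Hk] := cut_facet_at_apex C fQ gw gp.
    have [q1 _ _ _] := bary_q B; have [r1 _ _ _] := bary_r B.
    have gq : ev g q = 0 by apply: (mulfI k0); rewrite mulr0 -Hk.
    have gr : ev g r = 0 by apply: (mulfI k0); rewrite mulr0 -Hk.
    exact: (truncated_side (cut_rot C) eq er e2 e3 s2 s3 fQ FE gq gr).
  have [gq|gq] := eqVneq (ev g q) 0.
    exact: (truncated_side C ep eq e1 e2 s1 s2 fQ FE gp gq).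
  have [k k0 Hk] := cut_facet_at_apex (cut_rot C) fQ gw gq.
  have [_ r2 _ _] := bary_r B.
  have gr : ev g r = 0 by apply: (mulfI k0); rewrite mulr0 -Hk.
  exact: (truncated_side (cut_swap (cut_rot (cut_rot C))) ep er e1 e3 s1 s3 fQ FE gp gr).
move=> a b c d E _ _ away.
have M := cut_triangle_vertices C (And3 ep eq er) E.
have Qu u : extreme P u -> Q u by move=> [/HP[]].
have : a \in [:: p; q; r] by rewrite M !inE eqxx.
rewrite !inE => /or3P[] /eqP aE.
- by apply: (away u1 p (Qu _ e1) s1); rewrite -aE; exact: triangle1.
- by apply: (away u2 q (Qu _ e2) s2); rewrite -aE; exact: triangle1.
- by apply: (away u3 r (Qu _ e3) s3); rewrite -aE; exact: triangle1.
Qed.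
End Cuts.

(** * Undoing the attachments *)

Section Undo.
Variable R : realType.
Implicit Types (g h : 'cV[R]_3 * R) (a b c o p q r u v w x y z d : space R) (P Q F : set (space R)).

(** A triangular face of [P] in a facet plane of [Q] through [v] and [p] must be
    [u v p]; it comes from the triangular face [u p w] of [Q], which is
    adjacent to [p q w]. *)
Lemma shortened_side P Q v p q w lv lp lq lw g x a b c u : tetra_cut P Q v p q w lv lp lq lw ->
  extreme P v -> extreme P p -> extreme P u -> open_segment u w v ->
  facet_at Q g x -> P `&` [set y | ev g y = 0] = triangle a b c ->
  ev g v = 0 -> ev g p = 0 -> faces Q (triangle p q w) -> no_adjacent_triangles Q -> False.
Proof.
move=> C e_v ep eu uv fQ FE gv gp Fpqw nQ; have [g0 gQ gx _] := fQ.
have [B pP pQ HP HT] := C; have [Qv Qp Qq Qw] := cut_apex C.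
have Qu : Q u by case/HP: (eu.1).
have [gu gw] := open_segment_ev uv (gQ _ Qu) (gQ _ Qw) gv.
have hu := prolonged_below C uv.
have [v1 v2 v3 v4] := bary_p B; have [p1 p2 p3 p4] := bary_q B.
have cP := polytope_cvx pP.
have [Pu Pv Pp] : [/\ P u, P v & P p] by split; [case: eu|case: e_v|case: ep].
have M : [:: u; v; p] =i [:: a; b; c].
  apply: (@triangle_three_extreme _ P) => //; first by rewrite -FE => y [].
    rewrite /= !inE !negb_or !andbT; apply/andP; split; first (apply/andP; split); apply/eqP => F.
    - by move: hu; rewrite F v4 ltxx.
    - by move: hu; rewrite F p4 ltxx.
    - by move: v1; rewrite F p1 => /esym/eqP; rewrite oner_eq0.
  move=> y; rewrite -FE !inE => /or3P[] /eqP ->; split => //.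
have tv : triangle u p w v.
  move: uv => [t [/andP[t0 t1] ->]]; apply/triangleP; exists (1 - t), 0, t.
  by split; rewrite ?scale0r ?addr0 ?subrK //; lra.
have gq : ev g q != 0.
  apply/eqP => gq; have [y] := ev_nonconst v g0.
  by rewrite (bary_ev g y B) gv gp gq gw !mulr0 !addr0 eqxx.
have FQ : triangle u p w = Q `&` [set y | ev g y = 0].
  have cK : cvx (Q `&` [set y | ev g y = 0]).
    move=> y z t [Qy /= gy] [Qz /= gz] t01; split; first exact: polytope_cvx.
    by rewrite /= ev_comb gy gz !mulr0 addr0.
  apply/seteqP; split; first exact: triangle_sub.
  move=> y [Qy /= gy]; have [hy|/ltW hy] := leP (ev lw y) 0.
    have : triangle a b c y by rewrite -FE; split => //; apply/HP.
    have tri z : z \in [:: a; b; c] -> triangle u p w z.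
      rewrite -M !inE => /or3P[] /eqP -> //; [exact: triangle1|exact: triangle2].
    by apply: triangle_sub; [exact: triangle_cvx|apply: tri; rewrite !inE eqxx ?orbT..].
  have Ty : tetrahedron v p q w y by apply/HT.
  have [h1 h2 h3 h4] := (bary_tetrahedron y B).1 Ty.
  have hq : ev lq y = 0.
    have := bary_ev g y B; rewrite gy gv gp gw !mulr0 !add0r addr0 => /esym/eqP.
    by rewrite mulf_eq0 (negbTE gq) orbF => /eqP.
  have : triangle v p w y by apply/triangleP; exists (ev lv y), (ev lp y), (ev lw y); split => //;
    [have := bary_sum B y; rewrite hq addr0|have := bary_dec B y; rewrite hq scale0r addr0].
  by apply: triangle_sub; [exact: triangle_cvx|exact: tv|exact: triangle2|exact: triangle3].
have Fu : faces Q (triangle u p w) by apply/(polytope_faces _ pQ); exists g, x.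
have E : triangle p w u = triangle p w q.
  by apply: nQ; rewrite ?[triangle p w q]triangle_rot ?[triangle w q p]triangle_rot
    ?[triangle q p w]triangle_swap // -triangle_rot.
have : triangle p w q u by rewrite -E; exact: triangle3.
move/triangleP => [s [t [k [s0 t0 k0 stk uE]]]].
have [_ _ _ q4] := bary_r B; have [_ _ _ w4] := bary_w B.
have : ev lw u = t.
  by rewrite uE ev_comb3 // p4 q4 w4; ring.
lra.
Qed.

(** Undoing an attachment of type (iii) keeps the invariant. *)
Lemma shortening_step P Q v p q w lv lp lq lw u : tetra_cut P Q v p q w lv lp lq lw ->
  [/\ extreme P v, extreme P p & extreme P q] -> extreme P u -> open_segment u w v ->
  faces Q (triangle p q w) -> no_adjacent_triangles Q -> no_adjacent_triangles P.
Proof.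
move=> C [e_v ep eq] eu uv Fpqw nQ; have [B pP pQ HP HT] := C.
have [Qv Qp Qq Qw] := cut_apex C.
have [v1 v2 v3 v4] := bary_p B; have [p1 p2 p3 p4] := bary_q B; have [q1 q2 q3 q4] := bary_r B.
have [w1 w2 w3 w4] := bary_w B.
apply: (no_adjacent_triangles_cut C _ _ nQ).
  move=> g x a b c fP fQ FE; apply/eqP => gw.
  have [gv|gv] := eqVneq (ev g v) 0.
    have [gp|gp] := eqVneq (ev g p) 0.
      exact: (shortened_side C e_v ep eu uv fQ FE gv gp Fpqw nQ).
    have [k k0 Hk] := cut_facet_at_apex (cut_swap C) fQ gw gp.
    have gq : ev g q = 0 by apply: (mulfI k0); rewrite mulr0 -Hk.
    apply: (shortened_side (cut_swap (cut_rot (cut_rot C))) e_v eq eu uv fQ FE gv gq _ nQ).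
    by rewrite triangle_swap.
  (* Now the facet plane is the plane of [p q w], which [P] meets in [p q] only. *)
  have [k k0 Hk] := cut_facet_at_apex C fQ gw gv.
  have [g' [x' [fx' E']]] := (polytope_faces _ pQ).1 Fpqw.
  have on y : triangle p q w y -> ev g' y = 0 by rewrite E' => -[].
  have gw' := on _ (triangle3 p q w).
  have gv' : ev g' v != 0.
    apply/eqP => gv'; have [g0' _ _ _] := fx'; have [y] := ev_nonconst v g0'.
    by rewrite (bary_ev g' y B) gv' gw' (on _ (triangle1 p q w)) (on _ (triangle2 p q w)) !mulr0 !addr0 eqxx.
  have [k' k0' Hk'] := cut_facet_at_apex C fx' gw' gv'.
  have [_ _ gx nx] := fP; have Px := facet_mem fP; have [Qx hx] := (HP x).1 Px.
  have gx' : ev g' x = 0 by apply: (mulfI k0'); rewrite mulr0 -Hk' Hk gx mulr0.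
  have : triangle p q w x by rewrite E'.
  move=> /triangleP[s [t [m [s0 t0 m0 stm xE]]]].
  have hxm : ev lw x = m.
    by rewrite xE ev_comb3 // p4 q4 w4; ring.
  have hx0 : ev lw x = 0 by lra.
  have [||j Hj] := @facet_support _ P g (neg lw) x fP.
  - by move=> y /HP[_]; rewrite evN oppr_ge0.
  - by rewrite evN hx0 oppr0.
  by have := Hj w; rewrite gw mulr0 evN w4 => /eqP; rewrite oppr_eq0 oner_eq0.
move=> a b c d E Fd wd away.
have M := cut_triangle_vertices C (And3 e_v ep eq) E.
have Qu : Q u by case/HP: (eu.1).
have dv : ~ triangle a b d v by exact: away uv.
(* Hence [c = v], so the common edge is [p q]. *)
have av : a != v by apply/eqP => av; apply: dv; rewrite -av; exact: triangle1.
have bv : b != v by apply/eqP => bv; apply: dv; rewrite -bv; exact: triangle2.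
have ab : a != b.
  apply/eqP => ab; suff : (size [:: v; p; q] <= size [:: b; c])%N by [].
  apply: uniq_leq_size; first exact: bary_uniq B.
  by move=> y; rewrite M ab !inE => /orP[->|].
have aM : a \in [:: v; p; q] by rewrite M !inE eqxx.
have bM : b \in [:: v; p; q] by rewrite M !inE eqxx orbT.
have Fabw : faces Q (triangle a b w).
  move: aM bM ab; rewrite !inE (negbTE av) (negbTE bv) /=.
  move=> /orP[] /eqP -> /orP[] /eqP ->; rewrite ?eqxx // => _.
  by rewrite triangle_swap.
by apply: wd; rewrite (nQ _ _ _ _ Fd Fabw); exact: triangle3.
Qed.

Lemma tetrahedron_face p q r w lp lq lr lw : barycentric p q r w lp lq lr lw ->
  polytope (tetrahedron p q r w) -> faces (tetrahedron p q r w) (triangle p q r).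
Proof.
move=> B pT; apply/(polytope_faces _ pT).
have [p1 p2 p3 p4] := bary_p B; have [q1 q2 q3 q4] := bary_q B; have [r1 r2 r3 r4] := bary_r B.
have [w1 w2 w3 w4] := bary_w B.
(* The barycentre of the face. *)
pose x : space R := 3^-1 *: p + 3^-1 *: q + 3^-1 *: r.
have xE g : ev g x = 3^-1 * (ev g p + ev g q + ev g r) by rewrite /ev /x !linE; lra.
exists lw, x; split.
  split.
  - apply/eqP => lw0; move: p4 w4; rewrite /ev lw0 /lin !mulmx0 mxE => -> /eqP.
    by rewrite eq_sym oner_eq0.
  - by move=> y /(bary_tetrahedron y B)[].
  - by rewrite xE p4 q4 r4 !addr0 mulr0.
  - have np : nbhs x [set y | 0 < ev lp y] by apply: ev_gt0_near; rewrite xE p1 q1 r1; lra.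
    have nq : nbhs x [set y | 0 < ev lq y] by apply: ev_gt0_near; rewrite xE p2 q2 r2; lra.
    have nr : nbhs x [set y | 0 < ev lr y] by apply: ev_gt0_near; rewrite xE p3 q3 r3; lra.
    apply: filterS3 np nq nr => y h1 h2 h3 h4.
    by apply/(bary_tetrahedron y B); split => //; exact: ltW.
by apply/seteqP; split => y => [/(bary_triangle y B)|?]; last exact/(bary_triangle y B).
Qed.

Lemma ev_triangle0 g p q r x : ev g p = 0 -> ev g q = 0 -> ev g r = 0 ->
  triangle p q r x -> ev g x = 0.
Proof.
move=> gp gq gr /triangleP[s [t [k [_ _ _ stk ->]]]].
by rewrite ev_comb3 // gp gq gr !mulr0 !addr0.
Qed.

Lemma tetrahedron_faces_distinct p q r w : noncoplanar p q r w ->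
  [/\ triangle q r w <> triangle p r w, triangle p q w <> triangle p r w
    & triangle p q r <> triangle p q w].
Proof.
move=> /barycentricP[lp [lq [lr [lw B]]]].
have [p1 p2 _ p4] := bary_p B; have [q1 q2 _ q4] := bary_q B.
have [r1 r2 _ r4] := bary_r B; have [w1 w2 _ w4] := bary_w B.
split=> E.
- have : triangle q r w p by rewrite E; exact: triangle1.
  by move/(ev_triangle0 q1 r1 w1); rewrite p1 => /eqP; rewrite oner_eq0.
- have : triangle p r w q by rewrite -E; exact: triangle2.
  by move/(ev_triangle0 p2 r2 w2); rewrite q2 => /eqP; rewrite oner_eq0.
- have : triangle p q r w by rewrite E; exact: triangle3.
  by move/(ev_triangle0 p4 q4 r4); rewrite w4 => /eqP; rewrite oner_eq0.
Qed.

Lemma triangular_face_vertices P p q r : triangular_face P p q r ->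
  [/\ vertices P p, vertices P q & vertices P r].
Proof. by move=> [_ /edge_vertices[? ?] /edge_vertices[? ?] _]. Qed.

Lemma extended_straight_extreme P Q v w A B : polytope P -> extended_straight P Q v w A B ->
  exists2 u, extreme P u & open_segment u w v.
Proof.
move=> pP [u [E uwv _]]; exists u => //.
have [[+ _] _] : (incident_edges P v `\` [set A; B]) (segment u v) by rewrite E.
by move/edge_vertices => [/(polytope_vertex pP)].
Qed.

(** Induction on the construction: an obtainable polytope has two distinct
    triangular faces with a common edge. *)
Lemma obtainable_adjacent_triangles Q :
  obtainable Q -> polytope Q -> ~ no_adjacent_triangles Q.
Proof.
elim=> {Q} [p q r w npqrw|P Q _ IH att] pQ nQ.
  have [lp [lq [lr [lw B]]]] := barycentricP npqrw.
  have TE : tetrahedron p q r w = tetrahedron p q w r.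
    apply/seteqP; split => y.
      by move/(bary_tetrahedron y B) => [? ? ? ?]; apply/(bary_tetrahedron y (bary_swap_apex B)).
    by move/(bary_tetrahedron y (bary_swap_apex B)) => [? ? ? ?]; apply/(bary_tetrahedron y B).
  have [_ _] := tetrahedron_faces_distinct npqrw; apply; apply: nQ; first exact: tetrahedron_face B pQ.
  by rewrite TE in pQ *; exact: tetrahedron_face (bary_swap_apex B) pQ.
case: att => [[p [q [r [w [[[_ _ ne] _] [_ _ FE]]]]]]
  |[p [q [r [w [[[_ _ ne] _] [_ _ _ F1 F2]]]]]]
  |[v [p [q [w [H1 [[_ _ ext] [_ _ _ _ Fpqw]]]]]]]
  |[[p [q [r [w [H1 [_ _ [x1 x2 x3] _]]]]]]
  |[u [v [x [w [[[_ _ ne] _] [_ _ _ [F1 F2] _]]]]]]]].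
- have F1 : faces Q (triangle q r w) by rewrite FE; right; left; right.
  have F2 : faces Q (triangle p r w) by rewrite FE; right; right.
  have [+ _ _] := tetrahedron_faces_distinct ne; apply.
  by rewrite triangle_rot [RHS]triangle_rot; apply: nQ; rewrite -triangle_rot.
- have [_ + _] := tetrahedron_faces_distinct ne; apply.
  rewrite [LHS]triangle_swap triangle_rot [RHS]triangle_swap [RHS]triangle_rot.
  by apply: nQ; rewrite -triangle_rot triangle_swap.
- have [lv [lp [lq [lw C]]]] := one_face_cut pQ H1; have [_ pP _ _ _] := C.
  have [_ [tf _ _]] := H1; have [vv vp vq] := triangular_face_vertices tf.
  have [u eu uv] := extended_straight_extreme pP ext.
  apply: (IH pP); apply: (shortening_step C _ eu uv Fpqw nQ).
  by split; exact: polytope_vertex.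
- have [lp [lq [lr [lw C]]]] := one_face_cut pQ H1; have [_ pP _ _ _] := C.
  have [_ [tf _ _]] := H1; have [vp vq vr] := triangular_face_vertices tf.
  have [u1 e1 s1] := extended_straight_extreme pP x1.
  have [u2 e2 s2] := extended_straight_extreme pP x2.
  have [u3 e3 s3] := extended_straight_extreme pP x3.
  apply: (IH pP); apply: (truncation_step C _ _ _ nQ).
  + by split; exact: polytope_vertex.
  + by split; [exact: e1|exact: e2|exact: e3].
  + by split.
- have [+ _ _] := tetrahedron_faces_distinct ne; apply.
  by rewrite triangle_rot [RHS]triangle_rot; apply: nQ; rewrite -triangle_rot.
Qed.

End Undo.

(** * Boxes *)

Section Boxes.
Variable R : realType.
Implicit Types (g : 'cV[R]_3 * R) (a b c d o u v w x y z : space R).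

Lemma orthogonal_frame_free u v w : orthogonal_frame u v w -> row_free (col_mx u (col_mx v w)).
Proof.
move=> [[u0 v0 w0] [uv vw uw]].
have sq d : d != 0 -> (d *m d^T) 0 0 != 0.
  move=> d0; rewrite mxE; apply: contra_neq d0 => /eqP.
  rewrite psumr_eq0 => [/allP H|i _]; last by rewrite mxE -expr2 sqr_ge0.
  apply/rowP => i; have := H i (mem_index_enum i); rewrite /= !mxE -expr2 sqrf_eq0.
  by move/eqP.
have vu : v *m u^T = 0 by rewrite -[LHS]trmxK trmx_mul trmxK uv trmx0.
have wv : w *m v^T = 0 by rewrite -[LHS]trmxK trmx_mul trmxK vw trmx0.
have wu : w *m u^T = 0 by rewrite -[LHS]trmxK trmx_mul trmxK uw trmx0.
have cancel (k : 'M[R]_1) d : d != 0 -> k *m (d *m d^T) = 0 -> k = 0.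
  move=> /sq d0 /matrixP/(_ 0 0); rewrite !mxE big_ord1 => /eqP.
  rewrite mulf_eq0 (negbTE d0) orbF => /eqP k0.
  by apply/matrixP => i j; rewrite !ord1 k0 mxE.
apply: inj_row_free => k; rewrite -[k]hsubmxK -[rsubmx k]hsubmxK !mul_row_col.
move: (lsubmx k) (lsubmx (rsubmx k)) (rsubmx (rsubmx k)) => k1 k2 k3 E.
have E1 : k1 = 0.
  apply: (cancel _ u u0); have := congr1 (mulmx^~ u^T) E.
  by rewrite /= !mulmxDl -!mulmxA vu wu !mulmx0 !addr0 mul0mx.
have E2 : k2 = 0.
  apply: (cancel _ v v0); have := congr1 (mulmx^~ v^T) E.
  by rewrite /= !mulmxDl -!mulmxA uv wv !mulmx0 !addr0 add0r mul0mx.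
have E3 : k3 = 0.
  apply: (cancel _ w w0); have := congr1 (mulmx^~ w^T) E.
  by rewrite /= !mulmxDl -!mulmxA uw vw !mulmx0 !add0r mul0mx.
by rewrite E1 E2 E3 !row_mx0.
Qed.

Lemma halfspaces_interior (L : seq ('cV[R]_3 * R)) x :
  (forall g, g \in L -> 0 < ev g x) -> (halfspaces L)° x.
Proof.
elim: L => [|g L IH] H; first by apply: filterS filterT.
have H1 : nbhs x [set y | 0 < ev g y] by apply: ev_gt0_near; apply: H; rewrite inE eqxx.
have H2 : nbhs x (halfspaces L) by apply: IH => g' g'L; apply: H; rewrite inE g'L orbT.
apply: filterS2 H1 H2 => y gy Ly g'; rewrite inE => /orP[/eqP ->|]; first exact: ltW.
exact: Ly.
Qed.

(** A facet plane of a box is one of the six planes bounding it, so the facet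
    contains four corners, which are extreme points; it is not a triangle. *)
Lemma box_polytope o u v w : orthogonal_frame u v w ->
  polytope (box o u v w) /\ no_adjacent_triangles (box o u v w).
Proof.
move=> /orthogonal_frame_free/dual_basis[nu [nv [nw [dec [u1 u2 u3] [v1 v2 v3] [w1 w2 w3]]]]].
pose lu := through nu o; pose lv := through nv o; pose lw := through nw o.
(* With [lu], [lv], [lw] the coordinates of the box, [co l] stands for [1 - l]. *)
pose co g : 'cV[R]_3 * R := (- g.1, 1 - g.2).
have coE g y : ev (co g) y = 1 - ev g y by rewrite /ev /co /= linNn; ring.
pose L := [:: lu; lv; lw; co lu; co lv; co lw].
pose pt (r s t : R) : space R := o + r *: u + s *: v + t *: w.
have ptE (r s t : R) : [/\ ev lu (pt r s t) = r, ev lv (pt r s t) = s & ev lw (pt r s t) = t].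
  have E : pt r s t - o = r *: u + s *: v + t *: w by rewrite /pt; apply/matrixP => i j; rewrite !mxE; ring.
  rewrite /lu /lv /lw !ev_through E !linE u1 u2 u3 v1 v2 v3 w1 w2 w3.
  by split; ring.
have yE y : y = pt (ev lu y) (ev lv y) (ev lw y).
  by rewrite /pt /lu /lv /lw !ev_through -!addrA (addrA (lin nu _ *: u)) -dec subrKC.
have BE : box o u v w = halfspaces L.
  apply/seteqP; split => y.
    move=> [r [s [t [/andP[r0 r1] /andP[s0 s1] /andP[t0 t1] ->]]]] g.
    have [E1 E2 E3] := ptE r s t.
    rewrite !inE => /or4P[|||/or3P[]] /eqP ->; rewrite ?coE -/(pt r s t) ?E1 ?E2 ?E3 //; lra.
  move=> H; exists (ev lu y), (ev lv y), (ev lw y).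
  have in_ g : g \in L -> 0 <= ev g y := H g.
  have := in_ lu; have := in_ lv; have := in_ lw.
  have := in_ (co lu); have := in_ (co lv); have := in_ (co lw).
  rewrite !coE !inE !eqxx !orbT => /(_ isT) h1 /(_ isT) h2 /(_ isT) h3 /(_ isT) h4 /(_ isT) h5 /(_ isT) h6.
  split; last exact: yE.
  - by rewrite h6 /=; lra.
  - by rewrite h5 /=; lra.
  - by rewrite h4 /=; lra.
have pB : polytope (box o u v w).
  split; first by exists L.
  exists (pt 2^-1 2^-1 2^-1); rewrite BE; apply: halfspaces_interior => g.
  have [E1 E2 E3] := ptE 2^-1 2^-1 2^-1.
  by rewrite !inE => /or4P[|||/or3P[]] /eqP ->; rewrite ?coE ?E1 ?E2 ?E3; lra.
split => //.
pose corner (e : bool * bool * bool) := pt e.1.1%:R e.1.2%:R e.2%:R.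
have corner_inj : injective corner.
  move=> [[e1 e2] e3] [[e1' e2'] e3'] E.
  have [H1 H2 H3] := ptE e1%:R e2%:R e3%:R; have [H1' H2' H3'] := ptE e1'%:R e2'%:R e3'%:R.
  have b01 (b b' : bool) : b%:R = b'%:R :> R -> b = b'.
    by case: b; case: b' => // /eqP; rewrite ?oner_eq0 // eq_sym oner_eq0.
  rewrite -[pt _ _ _]/(corner (e1, e2, e3)) E /corner /= in H1 H2 H3.
  by congr (_, _, _); apply: b01; [rewrite -H1 H1'|rewrite -H2 H2'|rewrite -H3 H3'].
have box01 y g : box o u v w y -> g \in [:: lu; lv; lw] -> 0 <= ev g y <= 1.
  rewrite BE => H gL; apply/andP; split.
    by apply: H; move: gL; rewrite !inE => /or3P[] ->; rewrite ?orbT.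
  rewrite -subr_ge0 -coE; apply: H.
  by move: gL; rewrite !inE => /or3P[] /eqP ->; rewrite eqxx ?orbT.
have ext01 (b : bool) (t y z : R) : 0 < t < 1 -> 0 <= y <= 1 -> 0 <= z <= 1 ->
    b%:R = (1 - t) * y + t * z -> y = z.
  move=> /andP[t0 t1] /andP[y0 y1] /andP[z0 z1] E.
  have t1' : 0 < 1 - t by rewrite subr_gt0.
  case: b E => /= E; last first.
    have H1 := mulr_ge0 (ltW t0) z0; have H2 := mulr_ge0 (ltW t1') y0.
    have -> : y = 0 by apply: (mulfI (lt0r_neq0 t1')); rewrite mulr0; lra.
    by apply: (mulfI (lt0r_neq0 t0)); rewrite mulr0; lra.
  have z1' : 0 <= 1 - z by lra.
  have y1' : 0 <= 1 - y by lra.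
  have H1 := mulr_ge0 (ltW t0) z1'; have H2 := mulr_ge0 (ltW t1') y1'.
  have h : 1 - y = 0 by apply: (mulfI (lt0r_neq0 t1')); rewrite mulr0; lra.
  have h' : 1 - z = 0 by apply: (mulfI (lt0r_neq0 t0)); rewrite mulr0; lra.
  lra.
have corner_ext e : extreme (box o u v w) (corner e).
  case: e => [[e1 e2] e3]; split.
    exists e1%:R, e2%:R, e3%:R; split => //; [case: e1|case: e2|case: e3]; rewrite /= ?lexx ?ler01 //.
  move=> y z By Bz [t [t01 E]].
  have [H1 H2 H3] := ptE e1%:R e2%:R e3%:R.
  rewrite -[pt _ _ _]/(corner (e1, e2, e3)) E !ev_comb in H1 H2 H3.
  rewrite (yE y) (yE z).
  rewrite (ext01 e1 t (ev lu y) (ev lu z)) ?box01 ?inE ?eqxx ?orbT //.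
  rewrite (ext01 e2 t (ev lv y) (ev lv z)) ?box01 ?inE ?eqxx ?orbT //.
  by rewrite (ext01 e3 t (ev lw y) (ev lw z)) ?box01 ?inE ?eqxx ?orbT.
move=> a b c d /(polytope_faces _ pB)[g [x [fx FE]]] _; exfalso.
have [g' g'L gx'] : exists2 g', g' \in L & ev g' x = 0.
  apply: contrapT => H; apply: (facet_not_interior fx); rewrite BE.
  apply: halfspaces_interior => g' g'L; rewrite lt_neqAle; apply/andP; split.
    by apply/eqP => /esym h; apply: H; exists g'.
  by have := facet_mem fx; rewrite BE; apply.
have [|k Hk] := @facet_support _ (box o u v w) g g' x fx _ gx'.
  by rewrite BE => y; apply.
have four (s : seq (bool * bool * bool)) : uniq s -> (3 < size s)%N ->
    (exists y, ev g' y != 0) -> all (fun e => ev g' (corner e) == 0) s -> False.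
  move=> us ss [y gy] /allP H; move: ss; rewrite ltnNge -(size_map corner) => /negP; apply.
  apply: (@triangle_at_most_three _ (box o u v w) a b c _ (polytope_cvx pB)).
  - by rewrite FE => z [].
  - by rewrite map_inj_uniq.
  - move=> z /mapP[e es ->]; split; first exact: corner_ext.
    rewrite FE; split; first by case: (corner_ext e).
    have := H _ es; rewrite Hk mulf_eq0 => /orP[/eqP k0|/eqP//].
    by move: gy; rewrite Hk k0 mul0r eqxx.
have C e1 e2 e3 : [/\ ev lu (corner (e1, e2, e3)) = e1%:R, ev lv (corner (e1, e2, e3)) = e2%:R
    & ev lw (corner (e1, e2, e3)) = e3%:R] by exact: ptE.
have Cu e1 e2 e3 : ev lu (corner (e1, e2, e3)) = e1%:R by case: (C e1 e2 e3).
have Cv e1 e2 e3 : ev lv (corner (e1, e2, e3)) = e2%:R by case: (C e1 e2 e3).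
have Cw e1 e2 e3 : ev lw (corner (e1, e2, e3)) = e3%:R by case: (C e1 e2 e3).
pose sq (f : bool -> bool -> bool * bool * bool) := [:: f true true; f true false; f false true; f false false].
move: g'L; rewrite !inE => /or4P[|||/or3P[]] /eqP g'E; rewrite g'E in four.
- apply: (four (sq (fun e f => (false, e, f)))) => //=; last by rewrite !Cu !eqxx.
  by exists (corner (true, true, true)); rewrite Cu oner_eq0.
- apply: (four (sq (fun e f => (e, false, f)))) => //=; last by rewrite !Cv !eqxx.
  by exists (corner (true, true, true)); rewrite Cv oner_eq0.
- apply: (four (sq (fun e f => (e, f, false)))) => //=; last by rewrite !Cw !eqxx.
  by exists (corner (true, true, true)); rewrite Cw oner_eq0.
- apply: (four (sq (fun e f => (true, e, f)))) => //=; last by rewrite !coE !Cu !subrr !eqxx.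
  by exists (corner (false, true, true)); rewrite coE Cu subr0 oner_eq0.
- apply: (four (sq (fun e f => (e, true, f)))) => //=; last by rewrite !coE !Cv !subrr !eqxx.
  by exists (corner (true, false, true)); rewrite coE Cv subr0 oner_eq0.
- apply: (four (sq (fun e f => (e, f, true)))) => //=; last by rewrite !coE !Cw !subrr !eqxx.
  by exists (corner (true, true, false)); rewrite coE Cw subr0 oner_eq0.
Qed.

End Boxes.

Theorem mainTheorem4 (R : realType) (Q : set 'rV[R]_3) :
  cube Q \/ cuboid Q -> ~ obtainable Q.
Proof.
move=> H obQ; have [c [u [v [w [fr QE]]]]] : cuboid Q.
  by case: H => // -[c [u [v [w [fr _ _ QE]]]]]; exists c, u, v, w.
have [pB nB] := box_polytope c fr; rewrite QE in obQ.
exact: obtainable_adjacent_triangles obQ pB nB.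
Qed.
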